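(* The group $\mathbb P\mathrm{Aut}(L_{2,4})$ is of order $11520=768\cdot 15$ and is generated by (classes of) linear automorphisms of $L_{2,4}$ that are rational, i.e. have rational matrices. The group $\mathbb P_{+}\mathrm{Aut}_{\mathbb R}(L_{2,4})$ is of order $23040$ and is isomorphic to the Weyl group of type $D_6$. The subset of non-negative elements of $\mathbb P_{+}\mathrm{Aut}_{\mathbb R}(L_{2,4})$ is a subgroup of order $24$ and acts by relabeling the vertices of $K_4$.
   Context: Index the coordinates of $\mathbb C^6$ by the edges $ij$ ($1\le i<j\le4$) of the complete graph $K_4$. For $\mathbf p=(\mathbf p_1,\dots,\mathbf p_4)$ with $\mathbf p_i\in\mathbb C^2$ put $m_{ij}(\mathbf p)=\sum_{k=1}^2(\mathbf p_i^k-\mathbf p_j^k)^2$ (no conjugation). $M_{2,4}\subset\mathbb C^6$ is the set of all vectors $(m_{ij}(\mathbf p))_{ij}$, and $L_{2,4}\subset\mathbb C^6$ is its preimage under the coordinate-wise squaring map of $\mathbb C^6$. $\mathrm{Aut}(L_{2,4})$ is the group of non-singular complex $6\times6$ matrices $\mathbf A$ with $\mathbf A(L_{2,4})=L_{2,4}$; $\mathbb P\mathrm{Aut}(L_{2,4})$ is its quotient by the relation ''$\mathbf A'$ is a (non-zero) complex scalar multiple of $\mathbf A$''. $\mathrm{Aut}_{\mathbb R}(L_{2,4})$ is the subgroup of matrices with real entries, and $\mathbb P_{+}\mathrm{Aut}_{\mathbb R}(L_{2,4})$ is its quotient by the relation ''$\mathbf A'$ is a positive real scalar multiple of $\mathbf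 A$''. An element of the latter is non-negative if the matrices in its class have only non-negative entries. ''Acts by relabeling the vertices of $K_4$'' means that these elements are the classes of the edge permutation matrices induced by permutations of $\{1,2,3,4\}$. *)

(* Defs.v *)
From HB Require Import structures.
From mathcomp Require Import all_boot all_order all_algebra all_fingroup.
From mathcomp Require Import complex.
From mathcomp Require Import boolp classical_sets functions cardinality reals.

Set Implicit Arguments.
Unset Strict Implicit.
Unset Printing Implicit Defensive.

Import Order.TTheory GRing.Theory Num.Theory.

Local Open Scope classical_set_scope.
Local Open Scope ring_scope.
Local Open Scope quotient_scope.

Definition subgroup_set (G : groupType) (H : set G) : Prop :=
  group_closed (fun x : G => x \in H).

Definition group_closure (G : groupType) (S : set G) : set G :=
  [set x | forall H : set G, subgroup_set H -> S `<=` H -> H x].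

Lemma group_closure_subgroup (G : groupType) (S : set G) :
  subgroup_set (group_closure S).
Proof.
split=> [|x y /set_mem Sx /set_mem Sy]; apply/mem_set => H HG SH.
  by have [/set_mem] := HG.
by apply/set_mem; have [_] := HG; apply; apply/mem_set; [apply: Sx|apply: Sy].
Qed.

Record generated_type (G : groupType) (S : set G) := GeneratedType {
  generated_val :> G;
  _ : generated_val \in group_closure S }.

Section GeneratedType.
Variables (G : groupType) (S : set G).
HB.instance Definition _ := [isSub for @generated_val G S].
HB.instance Definition _ := [Choice of generated_type S by <:].
HB.instance Definition _ := SubChoice_isSubGroup.Build
  G (fun x : G => x \in group_closure S) (generated_type S)
  (group_closure_subgroup S).
End GeneratedType.

Record congruence (G : groupType) := Congruence {
  congruence_rel :> equiv_rel G;
  congruence_mul : forall x x' y y', congruence_rel x x' ->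
    congruence_rel y y' -> congruence_rel (x * y)%g (x' * y')%g }.

Definition quotg (G : groupType) (e : congruence G) : Type := {eq_quot e}.

Definition quotg_class (G : groupType) (e : congruence G) (x : G) : quotg e :=
  \pi_({eq_quot e}) x.

Section QuotientGroup.
Variables (G : groupType) (e : congruence G).

HB.instance Definition _ := Choice.on (quotg e).

Definition quotg_repr (x : quotg e) : G :=
  generic_quotient.repr (x : {eq_quot e}).

Definition quotg_mul (x y : quotg e) : quotg e :=
  quotg_class e (quotg_repr x * quotg_repr y)%g.
Definition quotg_one : quotg e := quotg_class e 1%g.
Definition quotg_inv (x : quotg e) : quotg e :=
  quotg_class e (quotg_repr x)^-1%g.

Lemma quotg_classP (x y : G) :
  reflect (quotg_class e x = quotg_class e y) (e x y).
Proof. exact: eqmodP. Qed.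

Lemma repr_class (x : G) : e (quotg_repr (quotg_class e x)) x.
Proof. by apply/quotg_classP; rewrite /quotg_class /quotg_repr reprK. Qed.

Lemma quotg_ind (P : quotg e -> Prop) :
  (forall x, P (quotg_class e x)) -> forall x, P x.
Proof. by move=> Pc; elim/quotP => x xE; rewrite -xE; apply: Pc. Qed.

Lemma quotg_class_mul (x y : G) :
  quotg_mul (quotg_class e x) (quotg_class e y) = quotg_class e (x * y)%g.
Proof. by apply/quotg_classP/congruence_mul; apply: repr_class. Qed.

Lemma quotg_class_inv (x : G) :
  quotg_inv (quotg_class e x) = quotg_class e x^-1%g.
Proof.
apply/quotg_classP; set r := quotg_repr _.
have rx : e r x by apply: repr_class.
have := congruence_mul (equiv_refl e r^-1%g)
  (congruence_mul rx (equiv_refl e x^-1%g)).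
by rewrite mulgV mulg1 mulgA mulVg mul1g equiv_sym.
Qed.

Lemma quotg_mulA : associative quotg_mul.
Proof.
elim/quotg_ind=> x; elim/quotg_ind=> y; elim/quotg_ind=> z.
by rewrite !quotg_class_mul mulgA.
Qed.

Lemma quotg_mul1 : left_id quotg_one quotg_mul.
Proof. by elim/quotg_ind=> x; rewrite quotg_class_mul mul1g. Qed.

Lemma quotg_mulr1 : right_id quotg_one quotg_mul.
Proof. by elim/quotg_ind=> x; rewrite quotg_class_mul mulg1. Qed.

Lemma quotg_mulV : left_inverse quotg_one quotg_inv quotg_mul.
Proof.
by elim/quotg_ind=> x; rewrite quotg_class_inv quotg_class_mul mulVg.
Qed.

Lemma quotg_mulrV : right_inverse quotg_one quotg_inv quotg_mul.
Proof.
by elim/quotg_ind=> x; rewrite quotg_class_inv quotg_class_mul mulgV.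
Qed.

HB.instance Definition _ := isGroup.Build (quotg e)
  quotg_mulA quotg_mul1 quotg_mulr1 quotg_mulV quotg_mulrV.

End QuotientGroup.

Record GL (F : fieldType) (n : nat) := MkGL {
  GL_val :> 'M[F]_n;
  GL_unit : GL_val \in unitmx }.

Section GLGroup.
Variables (F : fieldType) (n : nat).

HB.instance Definition _ := [isSub for @GL_val F n].
HB.instance Definition _ := [Choice of GL F n by <:].

Lemma GL_mul_subproof (A B : GL F n) : A *m B \in unitmx.
Proof. by rewrite unitmx_mul !GL_unit. Qed.
Definition GL_mul (A B : GL F n) : GL F n := MkGL (GL_mul_subproof A B).

Definition GL_one : GL F n := MkGL (unitmx1 F n).

Lemma GL_inv_subproof (A : GL F n) : invmx A \in unitmx.
Proof. by rewrite unitmx_inv GL_unit. Qed.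
Definition GL_inv (A : GL F n) : GL F n := MkGL (GL_inv_subproof A).

Lemma GL_mulA : associative GL_mul.
Proof. by move=> A B C; apply: val_inj; apply: mulmxA. Qed.
Lemma GL_mul1 : left_id GL_one GL_mul.
Proof. by move=> A; apply: val_inj; apply: mul1mx. Qed.
Lemma GL_mulr1 : right_id GL_one GL_mul.
Proof. by move=> A; apply: val_inj; apply: mulmx1. Qed.
Lemma GL_mulV : left_inverse GL_one GL_inv GL_mul.
Proof. by move=> A; apply: val_inj; apply/mulVmx/GL_unit. Qed.
Lemma GL_mulrV : right_inverse GL_one GL_inv GL_mul.
Proof. by move=> A; apply: val_inj; apply/mulmxV/GL_unit. Qed.

HB.instance Definition _ :=
  isGroup.Build (GL F n) GL_mulA GL_mul1 GL_mulr1 GL_mulV GL_mulrV.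

End GLGroup.

Definition preserves (F : fieldType) (n : nat) (L : set 'cV[F]_n) (A : GL F n)
    : bool :=
  `[< mulmx A @` L = L >].

Record linaut (F : fieldType) (n : nat) (L : set 'cV[F]_n) := Linaut {
  linaut_val :> GL F n;
  _ : preserves L linaut_val }.

Section LinautGroup.
Variables (F : fieldType) (n : nat) (L : set 'cV[F]_n).

HB.instance Definition _ := [isSub for @linaut_val F n L].
HB.instance Definition _ := [Choice of linaut L by <:].

Lemma preserves_group_closed : group_closed (preserves L).
Proof.
split=> [|A B /asboolP AL /asboolP BL]; apply/asboolP.
  by rewrite (_ : mulmx _ = id) ?image_id//; apply/funext => v; exact: mul1mx.
rewrite -[in LHS]BL image_comp -[RHS]AL; apply: eq_imagel => v _ /=.
by rewrite -mulmxA mulKmx ?GL_unit.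
Qed.

HB.instance Definition _ := SubChoice_isSubGroup.Build
  (GL F n) (preserves L) (linaut L) preserves_group_closed.

End LinautGroup.

(** In a [numClosedFieldType] the order compares only numbers with the same
    imaginary part, so [Num.real] is the set of numbers with zero imaginary
    part, and [0 < c] (resp. [0 <= c]) says that [c] is real and positive
    (resp. nonnegative). *)

Definition is_real (C : numClosedFieldType) (n : nat) (L : set 'cV[C]_n)
    (A : linaut L) : bool :=
  GL_val A \is a mxOver Num.real.

Record real_linaut (C : numClosedFieldType) (n : nat) (L : set 'cV[C]_n) :=
  RealLinaut {
    real_linaut_val :> linaut L;
    _ : is_real real_linaut_val }.

Section RealLinautGroup.
Variables (C : numClosedFieldType) (n : nat) (L : set 'cV[C]_n).

HB.instance Definition _ := [isSub for @real_linaut_val C n L].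
HB.instance Definition _ := [Choice of real_linaut L by <:].

Lemma mxOver_realP (A : 'M[C]_n) :
  reflect (map_mx Num.conj A = A) (A \is a mxOver Num.real).
Proof.
apply: (iffP mxOverP) => [Ar|AE i j].
  by apply/matrixP=> i j; rewrite mxE; apply/CrealP.
by apply/CrealP; rewrite -{2}AE mxE.
Qed.

Lemma is_real_group_closed : group_closed (@is_real C n L).
Proof.
split=> [|A B /mxOver_realP Ar /mxOver_realP Br]; apply/mxOver_realP.
  exact: map_mx1.
by rewrite /= map_mxM map_invmx Ar Br.
Qed.

HB.instance Definition _ := SubChoice_isSubGroup.Build
  (linaut L) (@is_real C n L) (real_linaut L) is_real_group_closed.

End RealLinautGroup.

Section Scaling.
Variables (F : fieldType) (n : nat) (G : groupType) (f : G -> 'M[F]_n).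
Hypothesis fM : forall A B, f (A * B)%g = f A *m f B.
Variable K : {pred F}.
Hypothesis K0 : 0 \notin K.
Hypothesis K1 : 1 \in K.
Hypothesis KM : {in K &, forall c d, c * d \in K}.
Hypothesis KV : {in K, forall c, c^-1 \in K}.

Definition scaling (A A' : G) : bool :=
  `[< exists2 c, c \in K & f A' = c *: f A >].

Lemma scaling_refl : reflexive scaling.
Proof. by move=> A; apply/asboolP; exists 1; rewrite // scale1r. Qed.

Lemma scaling_sym : symmetric scaling.
Proof.
have imp A B : scaling A B -> scaling B A.
  move=> /asboolP[c Kc E]; apply/asboolP; exists c^-1; first exact: KV.
  by rewrite E scalerA mulVf ?scale1r//; apply: contraNneq K0 => <-.
by move=> A B; apply/idP/idP; apply: imp.
Qed.

Lemma scaling_trans : transitive scaling.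
Proof.
move=> B A D /asboolP[c Kc E] /asboolP[d Kd E']; apply/asboolP.
by exists (d * c); rewrite ?KM// E' E scalerA.
Qed.

Definition scaling_equiv : equiv_rel G :=
  EquivRel scaling scaling_refl scaling_sym scaling_trans.

Lemma scaling_mul (A A' B B' : G) :
  scaling_equiv A A' -> scaling_equiv B B' ->
  scaling_equiv (A * B)%g (A' * B')%g.
Proof.
move=> /asboolP[c Kc E] /asboolP[d Kd E']; apply/asboolP.
by exists (c * d); rewrite ?KM// !fM E E' -scalemxAl -scalemxAr scalerA.
Qed.

Definition scaling_congruence : congruence G := Congruence scaling_mul.

End Scaling.

Section Projectivization.
Variables (C : numClosedFieldType) (n : nat) (L : set 'cV[C]_n).

Let K : {pred C} := fun c => c != 0.
Let Kp : {pred C} := fun c => 0 < c.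

Fact nonzero0 : 0 \notin K. Proof. by rewrite unfold_in eqxx. Qed.
Fact nonzero1 : 1 \in K. Proof. exact: oner_neq0. Qed.
Fact nonzeroM : {in K &, forall c d, c * d \in K}.
Proof. by move=> c d Kc Kd; apply: mulf_neq0. Qed.
Fact nonzeroV : {in K, forall c, c^-1 \in K}.
Proof. by move=> c Kc; apply: invr_neq0. Qed.

Fact positive0 : 0 \notin Kp. Proof. by rewrite unfold_in ltxx. Qed.
Fact positive1 : 1 \in Kp. Proof. exact: ltr01. Qed.
Fact positiveM : {in Kp &, forall c d, c * d \in Kp}.
Proof. by move=> c d Kc Kd; apply: mulr_gt0. Qed.
Fact positiveV : {in Kp, forall c, c^-1 \in Kp}.
Proof. by move=> c Kc; rewrite unfold_in invr_gt0. Qed.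

Fact linaut_valM (A B : linaut L) :
  GL_val (linaut_val (A * B)%g) = GL_val A *m GL_val B.
Proof. by []. Qed.
Fact real_linaut_valM (A B : real_linaut L) :
  GL_val (real_linaut_val (A * B)%g) = GL_val A *m GL_val B.
Proof. by []. Qed.

Definition scalar_congruence : congruence (linaut L) :=
  scaling_congruence linaut_valM nonzero0 nonzero1 nonzeroM nonzeroV.

Definition positive_congruence : congruence (real_linaut L) :=
  scaling_congruence real_linaut_valM positive0 positive1 positiveM positiveV.

Definition PAut : groupType := quotg scalar_congruence.
Definition PpAutR : groupType := quotg positive_congruence.

Definition PAut_class (A : linaut L) : PAut := quotg_class scalar_congruence A.
Definition PpAutR_class (A : real_linaut L) : PpAutR :=
  quotg_class positive_congruence A.

Lemma PAut_classP (A A' : linaut L) :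
  PAut_class A = PAut_class A' <->
  exists2 c : C, c != 0 & (A' : 'M_n) = c *: (A : 'M_n).
Proof.
by split=> [/quotg_classP/asboolP|e]; last apply/quotg_classP/asboolP.
Qed.

Lemma PpAutR_classP (A A' : real_linaut L) :
  PpAutR_class A = PpAutR_class A' <->
  exists2 c : C, 0 < c & (A' : 'M_n) = c *: (A : 'M_n).
Proof.
by split=> [/quotg_classP/asboolP|e]; last apply/quotg_classP/asboolP.
Qed.

Definition rational_linaut : set (linaut L) :=
  [set A | exists B : 'M[rat]_n, (A : 'M[C]_n) = map_mx ratr B].

Definition nonnegative : set PpAutR :=
  [set x | forall A : real_linaut L,
     PpAutR_class A = x -> (A : 'M[C]_n) \is a mxOver Num.nneg].

End Projectivization.

Arguments rational_linaut {C n} L.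
Arguments nonnegative {C n} L.

(** The Weyl group of the root system of type D_n, whose roots are the vectors
    e_i + e_j, e_i - e_j and - e_i - e_j of R^n with i and j distinct *)

Definition dotmx (R : fieldType) (n : nat) (u v : 'cV[R]_n) : R :=
  \sum_(i < n) u i 0 * v i 0.

Definition rootsD (R : realFieldType) (n : nat) : set 'cV[R]_n :=
  [set a | exists (i j : 'I_n) (s t : bool), i != j /\
     a = (-1) ^+ s *: delta_mx i 0 + (-1) ^+ t *: delta_mx j 0].

Definition is_reflection (R : realFieldType) (n : nat) (a : 'cV[R]_n) (A : GL R n)
    : Prop :=
  forall v : 'cV[R]_n, A *m v = v - (2 * dotmx v a / dotmx a a) *: a.

Definition weylD (R : realFieldType) (n : nat) : groupType :=
  generated_type [set A : GL R n | exists2 a, rootsD a & is_reflection a A].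

(* The edges 12, 13, 14, 23, 24, 34 of K_4, with vertices counted from 0 *)
Definition edge (k : 'I_6) : 'I_4 * 'I_4 :=
  let v0 := @Ordinal 4 0 isT in let v1 := @Ordinal 4 1 isT in
  let v2 := @Ordinal 4 2 isT in let v3 := @Ordinal 4 3 isT in
  tnth [tuple (v0, v1); (v0, v2); (v0, v3); (v1, v2); (v1, v3); (v2, v3)] k.

Lemma edge_inj : injective edge.
Proof.
move=> [[|[|[|[|[|[]]]]]]// ?] [[|[|[|[|[|[]]]]]]// ?];
  by move=> // /(congr1 (fun e : 'I_4 * 'I_4 => (val e.1, val e.2)))// _; apply: val_inj.
Qed.

Lemma edgeP (i j : 'I_4) : (i < j)%N <-> exists k, edge k = (i, j).
Proof.
split=> [|[[[|[|[|[|[|[]]]]]]// ?] [<- <-]]//].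
suff edgeE (k : 'I_6) :
    (edge k).1 = i :> nat -> (edge k).2 = j :> nat ->
    exists k, edge k = (i, j).
  move: edgeE; case: i j => [[|[|[|[|[]]]]]// ?] [[|[|[|[|[]]]]]// ?] edgeE // _;
  [ exact: (edgeE (@Ordinal 6 0 isT)) | exact: (edgeE (@Ordinal 6 1 isT))
  | exact: (edgeE (@Ordinal 6 2 isT)) | exact: (edgeE (@Ordinal 6 3 isT))
  | exact: (edgeE (@Ordinal 6 4 isT)) | exact: (edgeE (@Ordinal 6 5 isT)) ].
by move=> ki kj; exists k; case: (edge k) ki kj => a b /= /val_inj-> /val_inj->.
Qed.

Section SquaredLengths.
Variable C : numClosedFieldType.

Definition sqdist (p : 'M[C]_(4, 2)) (i j : 'I_4) : C :=
  \sum_(k < 2) (p i k - p j k) ^+ 2.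

Definition M24 : set 'cV[C]_6 :=
  range (fun p : 'M[C]_(4, 2) =>
    \col_(k < 6) sqdist p (edge k).1 (edge k).2).

Definition L24 : set 'cV[C]_6 :=
  map_mx (fun x : C => x ^+ 2) @^-1` M24.

(* The permutation matrix sending the basis vector of the edge ij to that of
   the edge s(i)s(j) *)
Definition relabeling_mx (s : 'S_4) : 'M[C]_6 :=
  \matrix_(k, l) ((edge k == (s (edge l).1, s (edge l).2)) ||
                  (edge k == (s (edge l).2, s (edge l).1)))%:R.

Definition relabelings : set (PpAutR L24) :=
  [set x | exists (s : 'S_4) (A : real_linaut L24),
     (A : 'M[C]_6) = relabeling_mx s /\ x = PpAutR_class A].

End SquaredLengths.

Arguments M24 : clear implicits.
Arguments L24 : clear implicits.
Arguments relabelings : clear implicits.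

(* Main.v *)
From HB Require Import structures.
Require Import Defs.
From mathcomp Require Import all_boot all_order all_algebra all_fingroup all_field.
From mathcomp Require Import complex ring.
From mathcomp Require Import boolp classical_sets functions cardinality reals.

(** Four points in the plane have a vanishing Cayley-Menger determinant, and over
    the complex numbers this is the only condition on their squared distances
    ([M24P]). So L_{2,4} is the hypersurface of a form of degree 6 in the edge
    lengths. Replace each pair of opposite edge lengths by its sum and its
    difference. In the new coordinates y_1, ..., y_6 the form is a multiple of

      p_2^3 - 6 p_2 p_4 + 8 p_6 - 48 y_1 y_2 y_3 y_4 y_5 y_6,

    where p_k is the k-th power sum ([sextic_frame]). It is invariant under
    permutations and even sign changes of the y_i, that is, under the Weyl group
    of type D_6. The main point is that there is no other linear automorphism of
    the hypersurface, up to scalars ([sextic_stabilizer]).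

    A linear map B that preserves the hypersurface multiplies the form by a
    constant ([sextic_proportional]), because on a generic line the form has six
    distinct zeros. Hence B permutes the points where the form has multiplicity
    3. These points are the multiples of the 32 sign vectors with an even number
    of minus signs ([triple_pointP], [triple_point_signs]): the second
    derivatives say that the y_i^2 are all roots of one quadratic polynomial,
    and together that its discriminant is zero. So each row of B, as a linear
    form, takes values with the same squares at all the even sign vectors. These
    squares determine the products of two distinct entries of a row
    ([eq_pair_products]); all rows of B share these products, and since B is
    invertible this leaves one nonzero entry in each row
    ([monomial_of_pair_products]). The nonzero entries agree up to sign, and B is
    a multiple of an even signed permutation.

    The rest is bookkeeping. There are 6! * 32 = 23040 even signed permutations.
    They are rational, give the classes modulo positive scalars of the real
    automorphisms, and form the group generated by the reflections in the roots
    of D_6 ([group_closure_reflections]). Modulo all scalars they are identified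
    in pairs, which leaves 11520. In the edge coordinates they are still
    orthogonal matrices, because the change of coordinates is orthogonal up to a
    factor; a nonnegative orthogonal matrix is a permutation matrix, and a
    permutation of the edges that preserves the hypersurface preserves the set
    of stars of the vertices of K_4 ([autmx_nonneg_relabeling]), so it is induced
    by a permutation of the vertices. *)

Set Implicit Arguments.
Unset Strict Implicit.
Unset Printing Implicit Defensive.

Import Order.TTheory GRing.Theory Num.Theory.

Local Open Scope ring_scope.

(** * The invariant sextic *)

Definition psum (R : comNzRingType) (k : nat) (y : 'cV[R]_6) : R :=
  \sum_i y i 0 ^+ k.

(** A multiple of the Cayley-Menger determinant of the squared edge lengths, when
    y is linked to the edge lengths by [frame] below. In the coordinates y it is
    visibly an invariant of the Weyl group of type D_6: the power sums of even
    degree ignore all signs, and the product ignores an even number of sign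
    changes. The ring is arbitrary because the sextic is also evaluated at points
    whose coordinates are polynomials. *)
Definition sextic (R : comNzRingType) (y : 'cV[R]_6) : R :=
  psum 2 y ^+ 3 - 6 * psum 2 y * psum 4 y + 8 * psum 6 y - 48 * \prod_i y i 0.

Lemma rmorph_sextic (R S : comNzRingType) (g : {rmorphism R -> S}) y :
  g (sextic y) = sextic (map_mx g y).
Proof.
have psumE k : g (psum k y) = psum k (map_mx g y).
  by rewrite rmorph_sum; apply: eq_bigr => i _; rewrite mxE rmorphXn.
rewrite /sextic rmorphB rmorphD rmorphB rmorphXn !rmorphM !psumE !rmorph_nat rmorph_prod.
by congr (_ - _ * _); apply: eq_bigr => i _; rewrite mxE.
Qed.

(** The parametrized line t |-> y + t v, as one point over the polynomial ring,
    so that restricting the sextic to it is an evaluation of the sextic. *)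
Definition line (R : comNzRingType) (y v : 'cV[R]_6) : 'cV[{poly R}]_6 :=
  map_mx polyC y + 'X *: map_mx polyC v.

Lemma lineE (R : comNzRingType) (y v : 'cV[R]_6) i :
  line y v i 0 = (y i 0)%:P + 'X * (v i 0)%:P.
Proof. by rewrite !mxE. Qed.

Lemma horner_line (R : comNzRingType) (y v : 'cV[R]_6) t :
  (sextic (line y v)).[t] = sextic (y + t *: v).
Proof.
rewrite -horner_evalE rmorph_sextic; congr sextic.
by apply/colP => i; rewrite !mxE /= /horner_eval !hornerE.
Qed.

Lemma map_line (R S : comNzRingType) (g : {rmorphism R -> S}) y v :
  map_poly g (sextic (line y v)) = sextic (line (map_mx g y) (map_mx g v)).
Proof.
rewrite rmorph_sextic; congr sextic; apply/colP => i.
by rewrite !mxE rmorphD rmorphM /= map_polyX !map_polyC.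
Qed.

(** Unlike a leading coefficient, c may be zero: the predicate is then stable
    under sums and products with no cancellation to be excluded. *)
Definition topcoef (R : comNzRingType) n (c : R) (p : {poly R}) :=
  (size p <= n.+1)%N /\ p`_n = c.

Section TopCoef.
Variable R : comNzRingType.
Implicit Types (p q : {poly R}) (c d : R).

Lemma topcoefP n c p : topcoef n c p <-> exists2 r : {poly R}, (size r <= n)%N & p = r +
  c *: 'X^n.
Proof.
split=> [[sp <-]|[r sr ->]].
  exists (p - p`_n *: 'X^n); last by rewrite subrK.
  apply/leq_sizeP => j; rewrite leq_eqVlt => /predU1P[<-|nj].
    by rewrite coefB coefZ coefXn eqxx mulr1 subrr.
  rewrite coefB coefZ coefXn gtn_eqF // mulr0 subr0.
  exact: (leq_sizeP _ _ sp).
split; last first.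
  by rewrite coefD coefZ coefXn eqxx mulr1 (leq_sizeP _ _ sr) ?add0r.
rewrite (leq_trans (size_polyD _ _)) // geq_max (leq_trans sr) //=.
by rewrite (leq_trans (size_scale_leq _ _)) // size_polyXn.
Qed.

Lemma topcoefD n c d p q : topcoef n c p -> topcoef n d q -> topcoef n (c + d) (p + q).
Proof.
move=> [sp <-] [sq <-]; split; last by rewrite coefD.
by rewrite (leq_trans (size_polyD _ _)) // geq_max sp.
Qed.

Lemma topcoefN n c p : topcoef n c p -> topcoef n (- c) (- p).
Proof. by move=> [sp <-]; split; rewrite ?size_polyN ?coefN. Qed.

Lemma topcoefM m n c d p q :
  topcoef m c p -> topcoef n d q -> topcoef (m + n) (c * d) (p * q).
Proof.
move=> /topcoefP[r sr ->] /topcoefP[s ss ->]; apply/topcoefP.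
exists (r * s + (d *: r * 'X^n + c *: s * 'X^m)); last first.
  rewrite exprD !scalerAl -!mul_polyC polyCM; ring.
have szM (a b : {poly R}) k l : (size a <= k -> size b <= l.+1 -> size (a * b)%R <= k + l)%N.
  move=> sa sb; have [->|a0] := eqVneq a 0; first by rewrite mul0r size_poly0.
  rewrite (leq_trans (size_polyMleq _ _)) // -ltnS prednK; last first.
    by rewrite (leq_trans _ (leq_addr _ _)) // size_poly_gt0.
  by rewrite -addnS leq_add.
rewrite (leq_trans (size_polyD _ _)) // geq_max szM ?(leqW ss) //=.
rewrite (leq_trans (size_polyD _ _)) // geq_max szM ?(leq_trans (size_scale_leq _ _))
  ?size_polyXn //=.
by rewrite addnC szM ?(leq_trans (size_scale_leq _ _)) ?size_polyXn.
Qed.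

Lemma topcoefC c : topcoef 0 c c%:P.
Proof. by split; rewrite ?size_polyC_leq1 ?coefC. Qed.

Lemma topcoefX n c p k : topcoef n c p -> topcoef (n * k) (c ^+ k) (p ^+ k).
Proof.
move=> tp; elim: k => [|k IH]; first by rewrite muln0 !expr0; exact: topcoefC.
by rewrite mulnS !exprS; apply: topcoefM.
Qed.

Lemma topcoef_sextic_line (y v : 'cV[R]_6) : topcoef 6 (sextic v) (sextic (line y v)).
Proof.
have tl i : topcoef 1 (v i 0) (line y v i 0).
  rewrite lineE; apply/topcoefP; exists (y i 0)%:P; rewrite ?size_polyC_leq1 //.
  by rewrite mulrC mul_polyC.
have tp k : topcoef k (psum k v) (psum k (line y v)).
  rewrite /psum; elim/big_ind2: _ => [|c p d q|i _]; last by rewrite -{1}[k]mul1n;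
    exact: topcoefX.
    by split; rewrite ?size_poly0 ?coef0.
  exact: topcoefD.
have tprod : topcoef 6 (\prod_i v i 0) (\prod_i line y v i 0).
  rewrite !big_ord_recr !big_ord0 /= !mul1r.
  apply: (@topcoefM 5 1) => //; apply: (@topcoefM 4 1) => //.
  apply: (@topcoefM 3 1) => //; apply: (@topcoefM 2 1) => //.
  exact: (@topcoefM 1 1).
have tZ n c p : topcoef n c p -> forall m, topcoef n (m%:R * c) (m%:R * p).
  by move=> t m; rewrite -polyC_natr; apply: (@topcoefM 0); first exact: topcoefC.
rewrite /sextic; apply: topcoefD; last exact/topcoefN/tZ.
apply: topcoefD; last exact/tZ.
apply: topcoefD; first exact: (@topcoefX 2).
by apply/topcoefN/(@topcoefM 2 4) => //; apply: tZ.
Qed.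

End TopCoef.

(** * Polynomials with the zeros of the sextic *)

Lemma poly_fun_eq0 (C : closedFieldType) (p : {poly C}) : (forall x, p.[x] = 0) -> p = 0.
Proof.
move=> p0; apply/eqP; apply/negPn/negP => /closed_nonrootP[x].
by rewrite /root p0 eqxx.
Qed.

(** The one-variable Nullstellensatz: a product of distinct linear factors
    divides whatever vanishes at its roots. *)
Lemma separable_dvdp (C : closedFieldType) (p q : {poly C}) :
  separable_poly p -> (forall x, root p x -> root q x) -> p %| q.
Proof.
move=> sp pq; have [r pE] := closed_field_poly_normal p.
have p0 := separable_poly_neq0 sp.
have l0 : lead_coef p != 0 by rewrite lead_coef_eq0.
have pr : p %= \prod_(z <- r) ('X - z%:P) by rewrite {1}pE eqp_scale.
rewrite (eqp_dvdl _ pr) uniq_roots_dvdp //; last first.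
  by rewrite uniq_rootsE -separable_prod_XsubC -(eqp_separable pr).
by apply/allP => z zr; rewrite pq // pE rootZ // root_prod_XsubC.
Qed.

(** A direction in which the sextic has degree exactly 6: its value there is the
    coefficient of t^6 on every line with this direction. *)
Definition axis0 (R : comNzRingType) : 'cV[R]_6 := delta_mx 0 0.

Lemma sextic_axis0 (R : comNzRingType) : sextic (axis0 R) = 3.
Proof.
by rewrite /sextic /psum !big_ord_recl !big_ord0 !mxE /=; ring.
Qed.

(** A base point for which the sextic on the line of direction [axis0] factors
    as 3 (t^2 - 5) (t^2 - 3) (t^2 + 3), with six distinct roots. *)
Definition sep_point (R : comNzRingType) : 'cV[R]_6 :=
  \col_(i < 6) (nth 0%N [:: 0; 1; 2]%N i)%:R.

Lemma sextic_line_axis0 (R : comNzRingType) :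
  sextic (line (sep_point R) (axis0 R)) = 3 * ('X ^+ 6 - 5 * 'X ^+ 4 - 9 * 'X ^+ 2 + 45).
Proof.
rewrite /sextic /psum !big_ord_recl !big_ord0 !mxE /= !polyC0 !polyC1 polyC_natr. ring.
Qed.

Lemma size_sextic_line_axis0 (R : comNzRingType) (u : 'cV[R]_6) :
  3 != 0 :> R -> size (sextic (line u (axis0 R))) = 7.
Proof.
have [s7 c6] := topcoef_sextic_line u (axis0 R).
move=> R3; apply/eqP; rewrite eqn_leq s7 /= ltnNge; apply/negP => /leq_sizeP/(_ 6 isT)/eqP.
by rewrite c6 sextic_axis0 (negPf R3).
Qed.

Section Proportional.
Variable C : numClosedFieldType.

Lemma separable_sep_point : separable_poly (sextic (line (sep_point C) (axis0 C))).
Proof.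
rewrite sextic_line_axis0 unlock /separable_poly; set p := (X in coprimep X).
apply/Bezout_coprimepP.
(* With s = 'X^2 the polynomial is 3 (s^3 - 5 s^2 - 9 s + 45). The polynomial B
   is the second factor of a Bezout identity in s between this cubic and its
   derivative; the constant term 45 removes the extra factor 'X of the
   derivative in 'X. *)
pose s : {poly C} := 'X ^+ 2.
pose B := 13 * s ^+ 2 - 20 * s - 153.
exists (2 * (45 * (- 5 - 39 * s) + B * (3 * s ^+ 2 - 10 * s - 9)),
        - (B * 'X * (s ^+ 2 - 5 * s - 9))).
rewrite (_ : _ + _ = (270 * 1152)%:P); last first.
  rewrite /= /p /B /s !derivE !polyCM !polyC_natr; ring.
by rewrite -size_poly_eq1 size_polyC mulf_neq0 ?pnatr_eq0.
Qed.

(** Separability is the nonvanishing of a resultant, which along the line from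
    u to [sep_point] is a polynomial D in the parameter s. It does not vanish at
    s = 1, hence it vanishes for finitely many s only. *)
Lemma generic_separable (u : 'cV[C]_6) :
  exists2 D : {poly C}, D != 0 & forall s, D.[s] != 0 ->
    separable_poly (sextic (line (u + s *: (sep_point C - u)) (axis0 C))).
Proof.
have P3 : 3 != 0 :> {poly C} by rewrite -polyC_natr polyC_eq0 pnatr_eq0.
pose P := sextic (line (line u (sep_point C - u)) (axis0 {poly C})).
have Ps s : map_poly (horner_eval s) P = sextic (line (u + s *: (sep_point C - u)) (axis0 C)).
  rewrite map_line map_delta_mx; congr (sextic (line _ _)).
  by apply/colP => i; rewrite !mxE /= /horner_eval !hornerE.
have sP : size P = 7 by rewrite size_sextic_line_axis0.
have P6 : P`_6 = 3.
  by have [_ ->] := topcoef_sextic_line (line u (sep_point C - u)) (axis0 {poly C});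
    rewrite sextic_axis0.
have lcP : lead_coef P = 3 by rewrite lead_coefE sP.
have P'5 : P^`()`_5 = 18 by rewrite coef_deriv P6; ring.
have P18 : 18 != 0 :> {poly C} by rewrite -polyC_natr polyC_eq0 pnatr_eq0.
have sP' : size P^`() = 6.
  have : (size P^`() < size P)%N by rewrite lt_size_deriv // -size_poly_gt0 sP.
  rewrite sP ltnS => s6; apply/eqP; rewrite eqn_leq s6 /=.
  rewrite ltnNge; apply/negP => /leq_sizeP/(_ 5 isT)/eqP.
  by rewrite P'5 (negPf P18).
have lcP' : lead_coef P^`() = 18 by rewrite lead_coefE sP'.
have Ds s : (resultant P P^`()).[s] != 0 <->
    separable_poly (sextic (line (u + s *: (sep_point C - u)) (axis0 C))).
  rewrite -horner_evalE map_resultant; last 2 first.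
  - by rewrite lcP rmorph_nat pnatr_eq0.
  - by rewrite lcP' rmorph_nat pnatr_eq0.
  rewrite resultant_eq0 -deriv_map Ps unlock /separable_poly coprimep_def.
  rewrite -leqNgt; split=> [s1|/eqP-> //].
  rewrite eqn_leq s1 size_poly_gt0 gcdp_eq0 negb_and -size_poly_gt0.
  by rewrite size_sextic_line_axis0 // pnatr_eq0.
exists (resultant P P^`()) => [|s /Ds//].
have /Ds : separable_poly (sextic (line (u + 1 *: (sep_point C - u)) (axis0 C))).
  by rewrite scale1r addrC subrK; exact: separable_sep_point.
by apply: contraNneq => ->; rewrite horner0.
Qed.

(** A form of the Nullstellensatz for the hypersurface of the sextic. On a line of
    direction [axis0] along which the sextic has six distinct zeros, sextic \o B
    has degree at most 6 and vanishes at these zeros, so it is a multiple of the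
    sextic; comparing the coefficients of t^6 shows that the factor does not
    depend on the line. All but finitely many points of the line through a given
    point and [sep_point] are on such lines, which is enough for a polynomial
    identity. *)
Lemma sextic_proportional (B : 'M[C]_6) :
  (forall y, sextic y = 0 -> sextic (B *m y) = 0) ->
  exists c, forall y, sextic (B *m y) = c * sextic y.
Proof.
move=> B0; pose c := sextic (B *m axis0 C) / 3; exists c => u.
have C3 : 3 != 0 :> C by rewrite pnatr_eq0.
have good w : separable_poly (sextic (line w (axis0 C))) -> sextic (B *m w) = c * sextic w.
  move=> sw; set p := sextic _ in sw; pose q := sextic (line (B *m w) (B *m axis0 C)).
  have sp : size p = 7 by rewrite size_sextic_line_axis0.
  have [_ p6] := topcoef_sextic_line w (axis0 C).
  have [q7 q6] := topcoef_sextic_line (B *m w) (B *m axis0 C).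
  have /dvdpP[d qE] : p %| q.
    apply: separable_dvdp => // x; rewrite /root !horner_line => /eqP/B0.
    by rewrite mulmxDr -scalemxAr => ->.
  have p0 : p != 0 by rewrite -size_poly_gt0 sp.
  have /size1_polyC dE : (size d <= 1)%N.
    have [->|d0] := eqVneq d 0; first by rewrite size_poly0.
    by move: q7; rewrite -/q qE size_mul // sp addnS => ?; rewrite -(leq_add2r 6).
  have d0 : d`_0 = c.
    by move: q6; rewrite -/q qE {1}dE mul_polyC coefZ p6 sextic_axis0 /c => <-; rewrite mulfK.
  have := congr1 (horner_eval 0) qE.
  by rewrite dE d0 /horner_eval hornerCM !horner_line !scale0r !addr0.
(* The identity holds at u + s w unless D.[s] = 0; as a polynomial identity in s
   it can be read at s = 0. *)
have [D D0 Dsep] := generic_separable u.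
pose w := sep_point C - u.
pose h := sextic (line (B *m u) (B *m w)) - c *: sextic (line u w).
have hE s : h.[s] = sextic (B *m (u + s *: w)) - c * sextic (u + s *: w).
  by rewrite /h hornerD hornerN hornerZ !horner_line mulmxDr scalemxAr.
have /eqP : D * h = 0.
  apply: poly_fun_eq0 => s; rewrite hornerM.
  have [->|/Dsep/good hs] := eqVneq D.[s] 0; first by rewrite mul0r.
  by rewrite hE hs subrr mulr0.
rewrite mulf_eq0 (negPf D0) /= => /eqP h0.
by move: (hE 0); rewrite h0 horner0 scale0r addr0 => /esym/eqP; rewrite subr_eq0 => /eqP.
Qed.

End Proportional.

(** * Triple points of the sextic *)

(** The permutation indexes the columns, so that the matrix sends y to the vector
    with coordinates (-1)^(e i) y_(s i) and products follow those of 'S_6. *)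
Definition spmx (R : nzRingType) (s : 'S_6) (e : 'I_6 -> bool) : 'M[R]_6 :=
  \matrix_(i, j) ((-1) ^+ e i *+ (j == s i)).

Definition even_signs (e : 'I_6 -> bool) := ~~ odd (\sum_i e i).

Lemma prod_even_signs (R : comNzRingType) e : even_signs e -> \prod_i (-1) ^+ e i = 1 :> R.
Proof. by move=> ev; rewrite prodrXr -signr_odd (negPf ev). Qed.

Lemma spmxE (R : nzRingType) s e m (y : 'M[R]_(6, m)) i k :
  (spmx R s e *m y) i k = (-1) ^+ e i * y (s i) k.
Proof.
rewrite mxE (bigD1 (s i)) //= !mxE eqxx big1 ?addr0 // => j /negPf ji.
by rewrite mxE ji mul0r.
Qed.

Lemma spmxM (R : nzRingType) s e s' e' :
  spmx R s e *m spmx R s' e' = spmx R (s * s')%g (fun i => e i (+) e' (s i)).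
Proof. by apply/matrixP => i j; rewrite spmxE !mxE permM signr_addb mulrnAr. Qed.

Lemma spmx1 (R : nzRingType) : spmx R 1%g (fun=> false) = 1%:M.
Proof. by apply/matrixP => i j; rewrite !mxE perm1 eq_sym. Qed.

Lemma spmx_unit (R : comUnitRingType) s e : spmx R s e \in unitmx.
Proof.
suff : spmx R s e *m spmx R s^-1%g (fun i => e (s^-1%g i)) = 1%:M by case/mulmx1_unit.
rewrite spmxM mulgV -spmx1; congr spmx.
by apply/funext => i; rewrite permK addbb.
Qed.

Lemma sextic_spmx (R : comNzRingType) s e (y : 'cV[R]_6) :
  even_signs e -> sextic (spmx R s e *m y) = sextic y.
Proof.
move=> ev; have psumE k : ~~ odd k -> psum k (spmx R s e *m y) = psum k y.
  move=> ek; rewrite [RHS](reindex_inj (@perm_inj _ s)); apply: eq_bigr => i _.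
  by rewrite spmxE exprMn -exprM mulnC exprM -signr_odd (negPf ek) expr0 expr1n mul1r.
rewrite /sextic !psumE //; congr (_ - _ * _).
under eq_bigr do rewrite spmxE.
by rewrite big_split /= prod_even_signs // mul1r [RHS](reindex_inj (@perm_inj _ s)).
Qed.

Section TriplePoint.
Variable C : numClosedFieldType.

(** The points of multiplicity at least 3, described through lines rather than
    through partial derivatives: invariance under linear maps is then
    immediate. *)
Definition triple_point (y : 'cV[C]_6) :=
  forall v k, (k < 3)%N -> (sextic (line y v))`_k = 0.

Lemma triple_pointM (B : 'M[C]_6) c y : B \in unitmx ->
  (forall x, sextic (B *m x) = c * sextic x) -> triple_point y -> triple_point (B *m y).
Proof.
move=> uB Bc ty v k k3; rewrite -[v](mulKVmx uB).
suff -> : sextic (line (B *m y) (B *m (invmx B *m v))) = c *: sextic (line y (invmx B *m v)).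
  by rewrite coefZ ty // mulr0.
apply/eqP; rewrite -subr_eq0; apply/eqP/poly_fun_eq0 => t.
by rewrite hornerD hornerN hornerZ !horner_line scalemxAr -mulmxDr Bc subrr.
Qed.

(** Multiplicity 3 only depends on polynomials modulo 'X^3, and jets are much
    cheaper to multiply than the polynomials themselves. *)
Definition jet (a b c : C) (p : {poly C}) := [/\ p`_0 = a, p`_1 = b & p`_2 = c].

Lemma jet_inj a b c a' b' c' p :
  jet a b c p -> a = a' -> b = b' -> c = c' -> jet a' b' c' p.
Proof. by move=> + <- <- <-. Qed.

Lemma jetD a b c a' b' c' p q :
  jet a b c p -> jet a' b' c' q -> jet (a + a') (b + b') (c + c') (p + q).
Proof. by move=> [<- <- <-] [<- <- <-]; split; rewrite coefD. Qed.

Lemma jetN a b c p : jet a b c p -> jet (- a) (- b) (- c) (- p).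
Proof. by move=> [<- <- <-]; split; rewrite coefN. Qed.

Lemma jetM a b c a' b' c' p q : jet a b c p -> jet a' b' c' q ->
  jet (a * a') (a * b' + b * a') (a * c' + b * b' + c * a') (p * q).
Proof.
by move=> [<- <- <-] [<- <- <-]; split; rewrite coefM !big_ord_recr big_ord0 /= add0r.
Qed.

Lemma jetC a : jet a 0 0 a%:P.
Proof. by split; rewrite coefC. Qed.

Lemma jet_line (y v : 'cV[C]_6) i : jet (y i 0) (v i 0) 0 (line y v i 0).
Proof.
by rewrite lineE; split; rewrite mulrC mul_polyC coefD coefZ coefC coefX ?(mulr0, mulr1,
  addr0, add0r).
Qed.

Lemma jetX a b c p k : jet a b c p ->
  jet (a ^+ k) (k%:R * a ^+ k.-1 * b)
    (k%:R * a ^+ k.-1 * c + 'C(k, 2)%:R * a ^+ k.-2 * b ^+ 2) (p ^+ k).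
Proof.
move=> jp; elim: k => [|k IH]; first by split; rewrite !expr0 coef1 ?mul0r ?addr0.
rewrite [p ^+ _]exprS; apply: jet_inj (jetM jp IH) _ _ _; first by rewrite exprS.
  by case: k {IH} => [|k]; rewrite /= ?expr0 ?exprS; ring.
rewrite binS bin1 natrD.
by case: k {IH} => [|[|k]]; rewrite /= ?(@bin_small 0) ?(@bin_small 1) // ?expr0 ?exprS; ring.
Qed.

Lemma jet_sextic a2 b2 c2 a4 b4 c4 a6 b6 c6 a b c (y : 'cV[{poly C}]_6) :
  jet a2 b2 c2 (psum 2 y) -> jet a4 b4 c4 (psum 4 y) -> jet a6 b6 c6 (psum 6 y) ->
  jet a b c (\prod_i y i 0) ->
  jet (a2 ^+ 3 - 6 * a2 * a4 + 8 * a6 - 48 * a)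
    (3 * a2 ^+ 2 * b2 - 6 * (a2 * b4 + b2 * a4) + 8 * b6 - 48 * b)
    (3 * a2 ^+ 2 * c2 + 3 * a2 * b2 ^+ 2 - 6 * (a2 * c4 + b2 * b4 + c2 * a4)
       + 8 * c6 - 48 * c) (sextic y).
Proof.
move=> j2 j4 j6 j1; have C32 : 'C(3, 2) = 3%N by [].
have jZ n a' b' c' p : jet a' b' c' p -> jet (n%:R * a') (n%:R * b') (n%:R * c') (n%:R * p).
  by move=> jp; rewrite -polyC_natr; apply: jet_inj (jetM (jetC _) jp) _ _ _; ring.
have := jetD (jetD (jetD (jetX 3 j2) (jetN (jetM (jZ 6 _ _ _ _ j2) j4))) (jZ 8 _ _ _ _ j6))
  (jetN (jZ 48 _ _ _ _ j1)).
by move/jet_inj; apply; rewrite /= ?C32; ring.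
Qed.

Let bins : ('C(2, 2) = 1) * ('C(4, 2) = 6) * ('C(6, 2) = 15). Proof. by []. Qed.

(** First and second derivative of the sextic along the i-th axis. Multiplying the
    first by y_i turns the product of the other coordinates into the full
    product, so both become expressions in z = y_i^2, the power sums and the
    product. *)
Lemma jet_sextic_line_delta (y : 'cV[C]_6) i
    (z := y i 0 ^+ 2) (p2 := psum 2 y) (p4 := psum 4 y) :
  let p := sextic (line y (delta_mx i 0)) in
  y i 0 * p`_1 = 6 * z * p2 ^+ 2 - 24 * p2 * z ^+ 2 - 12 * z * p4 + 48 * z ^+ 3
    - 48 * \prod_j y j 0 /\
  p`_2 = 3 * p2 ^+ 2 - 24 * p2 * z + 72 * z ^+ 2 - 6 * p4.
Proof.
have jl j : jet (y j 0) (j == i)%:R 0 (line y (delta_mx i 0) j 0).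
  by have := jet_line y (delta_mx i 0) j; rewrite mxE andbT.
have jp k : jet (psum k y) (k%:R * y i 0 ^+ k.-1) ('C(k, 2)%:R * y i 0 ^+ k.-2)
    (psum k (line y (delta_mx i 0))).
  have js (r : seq 'I_6) : uniq r -> jet (\sum_(j <- r) y j 0 ^+ k)
      (k%:R * y i 0 ^+ k.-1 *+ (i \in r)) ('C(k, 2)%:R * y i 0 ^+ k.-2 *+ (i \in r))
      (\sum_(j <- r) line y (delta_mx i 0) j 0 ^+ k).
    elim: r => [|j r IH] /=; first by rewrite !big_nil; split; rewrite coef0.
    case/andP=> jr /IH{}IH; rewrite !big_cons in_cons [i == j]eq_sym.
    apply: jet_inj (jetD (jetX k (jl j)) IH) _ _ _ => //.
      by case: eqP => [<-|_] /=; rewrite ?(negPf jr) /= ?mulr0n; ring.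
    by case: eqP => [<-|_] /=; rewrite ?(negPf jr) /= ?mulr0n; ring.
  by have := js (index_enum _) (index_enum_uniq _); rewrite mem_index_enum.
have jq : jet (\prod_j y j 0) (\prod_(j | j != i) y j 0) 0 (\prod_j line y (delta_mx i 0) j 0).
  have jr : jet (\prod_(j | j != i) y j 0) 0 0 (\prod_(j | j != i) line y (delta_mx i 0) j 0).
    elim/big_ind2: _ => [||j ji]; first exact: jetC.
      by move=> a p b q ja jb; apply: jet_inj (jetM ja jb) _ _ _; ring.
    by have := jl j; rewrite (negPf ji).
  rewrite [in X in jet X](bigD1 i) //= [in X in jet _ _ _ X](bigD1 i) //=.
  by apply: jet_inj (jetM (jl i) jr) _ _ _;
    rewrite ?eqxx ?mul1r ?mulr0 ?add0r ?mul0r ?addr0 //.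
have [_ p1E p2E] := jet_sextic (jp 2) (jp 4) (jp 6) jq.
move: p1E p2E; rewrite !bins => p1E p2E.
rewrite /= p1E p2E [\prod_j y j 0](bigD1 i) //= -/p2 -/p4 /z.
by move: (y i 0) (\prod_(_ | _) _) p2 p4 => x q p2' p4'; split; ring.
Qed.

(** At a triple point the squares z_i of the coordinates are roots of one and the
    same quadratic polynomial, whose coefficients are symmetric in the z_i. The
    sum of the six equations says that its discriminant is zero, so all the z_i
    are equal; the first derivative then determines the product. *)
Lemma triple_pointP y : triple_point y ->
  (forall i j, y i 0 ^+ 2 = y j 0 ^+ 2) /\ forall i, \prod_j y j 0 = y i 0 ^+ 6.
Proof.
move=> ty; set p2 := psum 2 y; set p4 := psum 4 y.
have tz i : 3 * p2 ^+ 2 - 24 * p2 * y i 0 ^+ 2 + 72 * (y i 0 ^+ 2) ^+ 2 - 6 * p4 = 0.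
  by have [_ <-] := jet_sextic_line_delta y i; rewrite ty.
have p4E : p4 = p2 ^+ 2 / 6.
  have : \sum_i (3 * p2 ^+ 2 - 24 * p2 * y i 0 ^+ 2 + 72 * (y i 0 ^+ 2) ^+ 2 - 6 * p4) = 0.
    exact: big1.
  rewrite !big_split /= -!mulr_sumr sumrN -mulr_sumr !sumr_const card_ord -/(psum 2 y) -/p2.
  under eq_bigr do rewrite -exprM.
  rewrite -/(psum 4 y) -/p4 => E; apply: (mulfI (_ : 36 != 0)); first by rewrite pnatr_eq0.
  by rewrite -[RHS]addr0 -E; field.
have zE i : y i 0 ^+ 2 = p2 / 6.
  apply/eqP; rewrite -subr_eq0 -[_ == 0](expf_eq0 _ 2).
  apply/eqP/(mulfI (_ : 72 != 0 :> C)); first by rewrite pnatr_eq0.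
  by rewrite mulr0 -(tz i) p4E; field.
split=> [i j|i]; first by rewrite !zE.
have [] := jet_sextic_line_delta y i;
  rewrite ty // mulr0 -/p2 -/p4 p4E (exprM _ 2 3) zE => + _.
move/esym/eqP; rewrite subr_eq0 => /eqP E.
apply: (mulfI (_ : 48 != 0)); first by rewrite pnatr_eq0.
by rewrite -E; field.
Qed.

(** By invariance it is enough to look at the vector of ones, where the jets only
    involve the first two power sums of the direction. *)
Lemma triple_point_signs e : even_signs e -> triple_point (\col_i (-1) ^+ e i).
Proof.
move=> ev.
have -> : \col_i (-1) ^+ e i = spmx C 1%g e *m const_mx 1.
  by apply/colP => i; rewrite spmxE !mxE mulr1.
apply: (@triple_pointM _ 1); first exact: spmx_unit.
  by move=> x; rewrite sextic_spmx // mul1r.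
move=> v.
have jl i : jet 1 (v i 0) 0 (line (const_mx 1) v i 0).
  by have := jet_line (const_mx 1) v i; rewrite mxE.
have jp k : jet 6 (k%:R * \sum_i v i 0) ('C(k, 2)%:R * \sum_i v i 0 ^+ 2)
    (psum k (line (const_mx 1) v)).
  have -> : 6 = \sum_(i < 6) 1 :> C by rewrite sumr_const card_ord.
  rewrite /psum; elim: (index_enum _) => [|i r IH].
    by rewrite !big_nil !mulr0; split; rewrite coef0.
  by rewrite !big_cons; apply: jet_inj (jetD (jetX k (jl i)) IH) _ _ _;
    rewrite !expr1n //; ring.
have jq : jet 1 (\sum_i v i 0) (((\sum_i v i 0) ^+ 2 - \sum_i v i 0 ^+ 2) / 2)
    (\prod_i line (const_mx 1) v i 0).
  elim: (index_enum _) => [|i r IH].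
    by rewrite !big_nil; split; rewrite coef1 // expr0n subrr mul0r.
  by rewrite !big_cons; apply: jet_inj (jetM (jl i) IH) _ _ _; [ring|ring|field].
have [c0 c1 c2] := jet_sextic (jp 2) (jp 4) (jp 6) jq.
move: c2; rewrite !bins => c2.
by case=> [|[|[|//]]] _; rewrite ?c0 ?c1 ?c2; [ring|ring|field].
Qed.

End TriplePoint.

(** * The linear stabilizer of the sextic *)

Definition signs (R : comNzRingType) (e : 'I_6 -> bool) : 'cV[R]_6 := \col_i (-1) ^+ e i.

Section Monomial.
Variable C : numClosedFieldType.

(** Averaging the squared form over sign vectors cancels every mixed product but
    the first. The vectors are cut out by evenness: with equal first two signs
    the last four run over the eight even patterns, with opposite first two signs
    over the eight odd ones. *)
Lemma polarize01 (a : 'I_6 -> C)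
  (f := fun t : seq bool => (\sum_i a i * (-1) ^+ nth false t i) ^+ 2)
  (T := [:: [:: false; false; false]; [:: false; true; true];
            [:: true; false; true]; [:: true; true; false]]) :
  32 * (a ord0 * a (lift ord0 ord0)) =
  \sum_(t <- T) (f [:: false, false, false & t] + f [:: false, false, true & map negb t])
  - \sum_(t <- T) (f [:: false, true, true & t] + f [:: false, true, false & map negb t]).
Proof.
rewrite /f /T !big_cons !big_nil /= !big_ord_recl !big_ord0 /= !expr0 !expr1.
move: (a _) (a _) (a _) (a _) (a _) (a _) => a0 a1 a2 a3 a4 a5.
ring.
Qed.

(** Products of two distinct coordinates of a linear form can be read off the
    squares of its values at the even sign vectors: modulo their global sign,
    these vectors form a group of order 16, and the products e_k e_l are pairwise
    distinct characters of it. *)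
Lemma eq_pair_products (a b : 'I_6 -> C) :
  (forall e, even_signs e ->
    (\sum_i a i * (-1) ^+ e i) ^+ 2 = (\sum_i b i * (-1) ^+ e i) ^+ 2) ->
  forall k l, k != l -> a k * a l = b k * b l.
Proof.
move=> ab k l kl.
have [s s0 s1] : exists2 s : 'S_6, s ord0 = k & s (lift ord0 ord0) = l.
  pose t := tperm ord0 k; have t0 : t ord0 = k by rewrite tpermL.
  exists (t * tperm (t (lift ord0 ord0)) l)%g; rewrite permM; last exact: tpermL.
  by rewrite t0 tpermD // 1?eq_sym // -t0 (inj_eq perm_inj).
have abs e : even_signs e -> (\sum_i a (s i) * (-1) ^+ e i) ^+ 2 = (\sum_i b (s i) * (-1)
  ^+ e i) ^+ 2.
  move=> ev; have /ab : even_signs (e \o s^-1%g).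
    by rewrite /even_signs (reindex_inj (@perm_inj _ s)) /=; under eq_bigr do rewrite permK.
  rewrite (reindex_inj (@perm_inj _ s)) [X in _ = X ^+ 2 -> _](reindex_inj (@perm_inj _ s)) /=.
  by under eq_bigr do rewrite permK; under [in X in _ = X -> _]eq_bigr do rewrite permK.
apply: (@mulfI _ 32); first by rewrite pnatr_eq0.
rewrite -s0 -s1 (polarize01 (a \o s)) (polarize01 (b \o s)).
by congr (_ - _); apply: eq_big_seq => t; rewrite !inE => /or4P[] /eqP->; congr (_ + _);
  apply: abs;
  rewrite /even_signs !big_ord_recl big_ord0.
Qed.

(** If a row had three nonzero entries, the pair products would determine every
    row up to sign; if it had exactly two, every row would be supported on the
    same two columns. Neither is possible for an invertible matrix. *)
Lemma monomial_of_pair_products (B : 'M[C]_6) : B \in unitmx ->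
  (forall i j k l, k != l -> B i k * B i l = B j k * B j l) ->
  forall i k l, k != l -> B i k != 0 -> B i l = 0.
Proof.
move=> uB BB i k l kl Bk; apply/eqP/negPn/negP => Bl.
have ker0 (x : 'cV_6) : B *m x = 0 -> x = 0 by move=> Bx; rewrite -(mulKmx uB x) Bx mulmx0.
have [m /and3P[mk ml Bm]|none] := pickP (fun m => [&& m != k, m != l & B i m != 0]).
  (* Columns k and l are then proportional. *)
  have dep j : B i l * B j k = B i k * B j l.
    have := BB i j l m; have := BB i j k m; rewrite ![_ == m]eq_sym => /(_ mk) E1 /(_ ml) E2.
    by apply: (mulfI Bm); rewrite mulrA [B i m * _]mulrC E2 mulrA [B i m * _]mulrC E1; ring.
  have /colP/(_ k)/eqP : B i l *: delta_mx k 0 - B i k *: delta_mx l 0 = 0 :> 'cV[C]_6.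
    by apply: ker0; apply/colP => j; rewrite mulmxBr -!scalemxAr -!colE !mxE dep subrr.
  by rewrite !mxE !eqxx (negPf kl) mulr1 mulr0 subr0 (negPf Bl).
have zero j m : m != k -> m != l -> B j m = 0.
  move=> mk ml; have := BB i j k m; rewrite eq_sym => /(_ mk).
  have := none m; rewrite mk ml /= => /negbFE/eqP-> /esym/eqP.
  rewrite mulr0 mulf_eq0 => /orP[] /eqP // z.
  by have /eqP := BB i j k l kl; rewrite z mul0r mulf_eq0 (negPf Bk) (negPf Bl).
have [m mk ml] : exists2 m, m != k & m != l.
  have /card_gt0P[m] : (0 < #|~: [set k;
    l]|)%N by rewrite cardsCs finset.setCK card_ord cards2 kl.
  by rewrite !inE negb_or => /andP[]; exists m.
have /colP/(_ m)/eqP : delta_mx m 0 = 0 :> 'cV[C]_6.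
  by apply: ker0; apply/colP => j; rewrite -colE !mxE zero.
by rewrite !mxE !eqxx oner_eq0.
Qed.

(** All the squares of the coordinates of B e are equal when e is an even sign
    vector, so all the rows of B have the same pair products and B is monomial.
    The vector of ones shows that the nonzero entries have equal squares, and
    that an even number of them differ in sign from the first one. *)
Lemma signed_perm_of_triple (B : 'M[C]_6) : B \in unitmx ->
  (forall e, even_signs e -> triple_point (B *m signs C e)) ->
  exists c s e, [/\ c != 0, even_signs e & B = c *: spmx C s e].
Proof.
move=> uB TB.
have BsE e i : (B *m signs C e) i 0 = \sum_k B i k * (-1) ^+ e k.
  by rewrite mxE; apply: eq_bigr => k _; rewrite mxE.
have BB i j k l : k != l -> B i k * B i l = B j k * B j l.
  apply: eq_pair_products => e ev; rewrite -!BsE.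
  by have [+ _] := triple_pointP (TB e ev); exact.
have B1 := monomial_of_pair_products uB BB.
have [s0 s0P] : exists s0, forall i, B i (s0 i) != 0.
  apply: (@fin_all_exists _ _ (fun i k => B i k != 0)) => i.
  have [k Bk|Bi] := pickP (fun k => B i k != 0); first by exists k.
  have /rowP/(_ i)/eqP : delta_mx 0 i = 0 :> 'rV[C]_6.
    rewrite -[LHS](mulmxK uB) -rowE (_ : row i B = 0) ?mul0mx //.
    by apply/rowP => k; rewrite !mxE; apply/eqP/negbFE/Bi.
  by rewrite !mxE !eqxx oner_eq0.
have Bs0 i k : k != s0 i -> B i k = 0 by rewrite eq_sym => /B1; apply.
have s0_inj : injective s0.
  move=> i j sij; apply/eqP/negPn/negP => ij.
  have /rowP/(_ i)/eqP : B j (s0 j) *: delta_mx 0 i - B i (s0 i) *: delta_mx 0 j = 0 :>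
    'rV[C]_6.
    rewrite -[LHS](mulmxK uB) (_ : _ *m B = 0) ?mul0mx //.
    apply/rowP => k; rewrite mulmxBl -!scalemxAl -!rowE !mxE.
    have [->|ki] := eqVneq k (s0 i); first by rewrite sij mulrC subrr.
    by rewrite (Bs0 i k) // (Bs0 j k) -?sij // !mulr0 subrr.
  by rewrite !mxE !eqxx (negPf ij) mulr1 mulr0 subr0 (negPf (s0P j)).
pose c := B ord0 (s0 ord0).
have b1 i : (B *m signs C (fun=> false)) i 0 = B i (s0 i).
  by rewrite BsE (bigD1 (s0 i)) //= mulr1 big1 ?addr0 // => k /Bs0->; rewrite mul0r.
have ev0 : even_signs (fun=> false) by rewrite /even_signs big1.
have [sq prod6] := triple_pointP (TB _ ev0).
pose e i := B i (s0 i) != c.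
have eE i : B i (s0 i) = (-1) ^+ e i * c.
  rewrite /e; have [->|/= nc] := eqVneq; first by rewrite mul1r.
  by have /eqP := sq i ord0; rewrite !b1 eqf_sqr (negPf nc) => /eqP->; rewrite expr1 mulN1r.
exists c, (perm s0_inj), e; split; first exact: s0P.
  have := prod6 ord0; rewrite b1 -/c; under eq_bigr do rewrite b1 eE.
  rewrite big_split /= prodr_const card_ord prodrXr -[RHS]mul1r => /(mulIf _).
  rewrite expf_neq0 ?s0P // => /(_ isT) /eqP; rewrite /even_signs -signr_odd.
  by case: odd => //; rewrite expr1 eq_sym -subr_eq0 opprK -[_ == _]/(2 == 0 :> C) pnatr_eq0.
apply/matrixP => i k; rewrite !mxE permE.
have [->|/Bs0->] := eqVneq; first by rewrite mulr1n mulrC -eE.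
by rewrite mulr0n mulr0.
Qed.

(** A linear map that preserves the zeros preserves the sextic up to a factor,
    hence its triple points, which include the even sign vectors. *)
Theorem sextic_stabilizer (B : 'M[C]_6) : B \in unitmx ->
  (forall y, sextic y = 0 -> sextic (B *m y) = 0) ->
  exists c s e, [/\ c != 0, even_signs e & B = c *: spmx C s e].
Proof.
move=> uB /sextic_proportional[c Bc]; apply: signed_perm_of_triple => // e ev.
exact/(triple_pointM uB Bc)/triple_point_signs.
Qed.

End Monomial.

(** * The sextic and planar quadruples *)

(** A multiple of the Cayley-Menger determinant of four points with squared
    distances a, ..., f along the edges 12, 13, 14, 23, 24, 34, in the form of
    Tartaglia: the pairs of opposite edges against the four faces. *)
Definition cayley (R : comNzRingType) (a b c d e f : R) : R :=
  a * f * (b + e + c + d - a - f) + b * e * (a + f + c + d - b - e)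
  + c * d * (a + f + b + e - c - d) - a * b * d - a * c * e - b * c * f - d * e * f.

Section Planar.
Variable C : numClosedFieldType.

Definition dist2 (p q : C * C) : C := (p.1 - q.1) ^+ 2 + (p.2 - q.2) ^+ 2.

Definition planar (a b c d e f : C) := exists p q r s : C * C,
  [/\ dist2 p q = a, dist2 p r = b & dist2 p s = c] /\
  [/\ dist2 q r = d, dist2 q s = e & dist2 r s = f].

Lemma dist2C p q : dist2 p q = dist2 q p.
Proof. by rewrite /dist2; ring. Qed.

Lemma planar_cayley a b c d e f : planar a b c d e f -> cayley a b c d e f = 0.
Proof.
move=> [[p1 p2] [[q1 q2] [[r1 r2] [[s1 s2] [[<- <- <-] [<- <- <-]]]]]].
by rewrite /cayley /dist2 /=; ring.
Qed.

(** Put the first point at the origin and the second on the first axis, which is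
    possible as a != 0 has a square root. The determinant of the Gram matrix of
    the last three points is a multiple of [cayley]; its vanishing says that the
    two remaining second coordinates have the right product up to sign, and the
    sign can be corrected in one of them. *)
Lemma cayley_planar_nz a b c d e f : a != 0 -> cayley a b c d e f = 0 -> planar a b c d e f.
Proof.
move=> a0 cm0; pose u := (a + b - d) / 2; pose v := (a + c - e) / 2; pose w := (b + c - f) / 2.
pose r := sqrtC a; have ra : r ^+ 2 = a by rewrite sqrtCK.
have r0 : r != 0 by rewrite sqrtC_eq0.
pose x := sqrtC (b - u ^+ 2 / a); have xE : x ^+ 2 = b - u ^+ 2 / a by rewrite sqrtCK.
have [y yE xy] : exists2 y, y ^+ 2 = c - v ^+ 2 / a & x * y = w - u * v / a.
  pose y := sqrtC (c - v ^+ 2 / a); have yE : y ^+ 2 = c - v ^+ 2 / a by rewrite sqrtCK.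
  have : (x * y) ^+ 2 = (w - u * v / a) ^+ 2.
    rewrite exprMn xE yE; apply/eqP; rewrite -subr_eq0; apply/eqP.
    transitivity (cayley a b c d e f / (4 * a)); last by rewrite cm0 mul0r.
    by rewrite /cayley /u /v /w; field.
  move/eqP; rewrite eqf_sqr => /orP[] /eqP E; first by exists y.
  by exists (- y); rewrite ?sqrrN // mulrN E opprK.
exists (0, 0), (r, 0), (u / r, x), (v / r, y); rewrite /dist2 /=.
have E1 : (u / r) ^+ 2 = u ^+ 2 / a by rewrite expr_div_n ra.
have E2 : (v / r) ^+ 2 = v ^+ 2 / a by rewrite expr_div_n ra.
split; split.
- by rewrite -ra; ring.
- by rewrite !sub0r !sqrrN E1 xE; ring.
- by rewrite !sub0r !sqrrN E2 yE; ring.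
- rewrite sub0r sqrrN xE; transitivity (r ^+ 2 - 2 * u * (r / r) + (u / r) ^+ 2 + (b - u
  ^+ 2 / a)).
    by field; rewrite r0 ?a0.
  by rewrite E1 ra divff // /u; field.
- rewrite sub0r sqrrN yE; transitivity (r ^+ 2 - 2 * v * (r / r) + (v / r) ^+ 2 + (c - v
  ^+ 2 / a)).
    by field; rewrite r0 ?a0.
  by rewrite E2 ra divff // /v; field.
transitivity (u ^+ 2 / r ^+ 2 - 2 * u * v / r ^+ 2 + v ^+ 2 / r ^+ 2 + (x ^+ 2 - 2 * (x *
  y) + y ^+ 2)).
  by field; rewrite ?a0 ?r0.
by rewrite xE yE xy ra /w; field.
Qed.

(** Relabel the points so that a nonzero squared distance comes first. *)
Lemma cayley_planar a b c d e f : cayley a b c d e f = 0 -> planar a b c d e f.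
Proof.
move=> cm0.
have [a0|a0] := eqVneq a 0; last exact: cayley_planar_nz.
have [b0|b0] := eqVneq b 0; last first.
  have [|p [r [q [s [[? ? ?] [? ? ?]]]]]] := @cayley_planar_nz b a c d f e b0.
    by rewrite -cm0 /cayley; ring.
  by exists p, q, r, s; rewrite (dist2C q r).
have [c0|c0] := eqVneq c 0; last first.
  have [|p [s [r [q [[? ? ?] [? ? ?]]]]]] := @cayley_planar_nz c b a f e d c0.
    by rewrite -cm0 /cayley; ring.
  by exists p, q, r, s; rewrite (dist2C q r) (dist2C q s) (dist2C r s).
have [d0|d0] := eqVneq d 0; last first.
  have [|r [q [p [s [[? ? ?] [? ? ?]]]]]] := @cayley_planar_nz d b f a e c d0.
    by rewrite -cm0 /cayley; ring.
  by exists p, q, r, s; rewrite (dist2C p q) (dist2C p r) (dist2C q r).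
have [e0|e0] := eqVneq e 0; last first.
  have [|s [q [r [p [[? ? ?] [? ? ?]]]]]] := @cayley_planar_nz e f c d a b e0.
    by rewrite -cm0 /cayley; ring.
  by exists p, q, r, s; rewrite (dist2C p q) (dist2C p r) (dist2C p s) (dist2C q s)
    (dist2C r s).
have [f0|f0] := eqVneq f 0; last first.
  have [|r [s [p [q [[? ? ?] [? ? ?]]]]]] := @cayley_planar_nz f b d c e a f0.
    by rewrite -cm0 /cayley; ring.
  by exists p, q, r, s; rewrite (dist2C p r) (dist2C p s) (dist2C q r) (dist2C q s).
exists (0, 0), (0, 0), (0, 0), (0, 0); rewrite /dist2 /= subrr expr0n /= addr0.
by rewrite a0 b0 c0 d0 e0 f0.
Qed.

Lemma M24P (X : 'cV[C]_6) (x := fun k (lt_k6 : (k < 6)%N) => X (Ordinal lt_k6) 0) :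
  M24 C X <-> cayley (x 0 isT) (x 1 isT) (x 2 isT) (x 3 isT) (x 4 isT) (x 5 isT) = 0.
Proof.
pose o k (lt_k4 : (k < 4)%N) := Ordinal lt_k4.
split=> [[p _ XE]|/cayley_planar[p [q [r [s [[pq pr ps] [qr qs rs]]]]]]].
  pose P i := (p i ord0, p i (lift ord0 ord0)).
  have PE i j : dist2 (P i) (P j) = sqdist p i j.
    by rewrite /sqdist !big_ord_recl big_ord0 addr0.
  apply: planar_cayley; exists (P (o 0 isT)), (P (o 1 isT)), (P (o 2 isT)), (P (o 3 isT)).
  by rewrite /x -XE !PE !mxE.
pose P : 'M[C]_(4, 2) := \matrix_(i, k)
  let z := nth (0, 0) [:: p; q; r; s] i in if k == 0 then z.1 else z.2.
have PE i j : sqdist P i j = dist2 (nth (0, 0) [:: p; q; r; s] i) (nth (0, 0) [:: p; q;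
  r; s] j).
  by rewrite /sqdist !big_ord_recr big_ord0 /= add0r !mxE.
exists P => //; apply/colP => -[[|[|[|[|[|[|//]]]]]] lt_k6]; rewrite mxE PE;
  rewrite ?pq ?pr ?ps ?qr ?qs ?rs /x; congr (X _ _); exact: val_inj.
Qed.

End Planar.

(** Opposite edges are paired. The six edges become mutually orthogonal roots of
    the system D_6, namely e_1 + e_2 and e_1 - e_2 for the first pair, and so
    on. *)
Definition frame_rows : seq (seq int) :=
  [:: [:: 1; 0; 0; 0; 0; 1]; [:: 1; 0; 0; 0; 0; -1]; [:: 0; 1; 0; 0; 1; 0];
      [:: 0; 1; 0; 0; -1; 0]; [:: 0; 0; 1; 1; 0; 0]; [:: 0; 0; 1; -1; 0; 0]].

Definition frame (R : nzRingType) : 'M[R]_6 := \matrix_(i, j) ((nth [::] frame_rows i)`_j)%:~R.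

Lemma sextic_frame (R : comNzRingType) (y : 'cV[R]_6)
  (x := fun k (lt_k6 : (k < 6)%N) => y (Ordinal lt_k6) 0) :
  sextic (frame R *m y) = - 96 * cayley (x 0 isT ^+ 2) (x 1 isT ^+ 2) (x 2 isT ^+ 2)
    (x 3 isT ^+ 2) (x 4 isT ^+ 2) (x 5 isT ^+ 2).
Proof.
have fE i : (frame R *m y) i 0 = \sum_(j < 6) ((nth [::] frame_rows i)`_j)%:~R * y j 0.
  by rewrite mxE; apply: eq_bigr => j _; rewrite mxE.
have yE (i : 'I_6) k (lt_k6 : (k < 6)%N) : i = k :> nat -> y i 0 = x k lt_k6.
  by move=> ik; congr (y _ _); apply: val_inj.
have {}fE (i : 'I_6) (r := nth [::] frame_rows i) : (frame R *m y) i 0 =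
    (r`_0)%:~R * x 0 isT + (r`_1)%:~R * x 1 isT + (r`_2)%:~R * x 2 isT + (r`_3)%:~R * x 3 isT
    + (r`_4)%:~R * x 4 isT + (r`_5)%:~R * x 5 isT.
  rewrite fE !big_ord_recr big_ord0 /= add0r.
  by do !congr (_ + _); congr (_ * _); exact: yE.
rewrite /sextic /psum !big_ord_recl !big_ord0 !fE /= !mulr0z !mulrNz !mulr1z.
move: (x 0 isT) (x 1 isT) (x 2 isT) (x 3 isT) (x 4 isT) (x 5 isT) => a b c d e f.
rewrite /cayley; ring.
Qed.

Lemma L24P (C : numClosedFieldType) (y : 'cV[C]_6) : L24 C y <-> sextic (frame C *m y) = 0.
Proof.
rewrite /L24 /preimage /= M24P sextic_frame !mxE; split=> [->|/eqP]; first by rewrite mulr0.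
by rewrite mulf_eq0 oppr_eq0 pnatr_eq0 => /eqP.
Qed.

(** * Even signed permutations *)

Lemma odd_sum (n : nat) (e : 'I_n -> bool) : odd (\sum_i e i) = \big[addb/false]_i e i.
Proof. by rewrite (big_morph odd oddD (erefl _)); apply: eq_bigr => i _; case: (e i). Qed.

Lemma even_signs_mul (s : 'S_6) e e' :
  even_signs e -> even_signs e' -> even_signs (fun i => e i (+) e' (s i)).
Proof.
rewrite /even_signs !odd_sum big_split /= => /negbTE-> ev'.
by rewrite [X in _ (+) X](_ : _ = \big[addb/false]_i e' i) // [RHS](reindex_inj
  (@perm_inj _ s)).
Qed.

Lemma even_signs_neg e b : even_signs e -> even_signs (fun i => b (+) e i).
Proof.
by rewrite /even_signs !odd_sum big_split /= => /negbTE->;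
  rewrite !big_ord_recr big_ord0 /=; case: b.
Qed.

(** An even sign vector is determined by its first five signs; taking out the
    global sign normalizes the first one to be plus. What is left is a finite
    type of visible cardinality 16. *)
Definition code : finType := (bool * bool * bool * bool)%type.

Definition code_signs (t : code) (i : 'I_6) : bool :=
  let: (a, b, c, d) := t in nth false [:: false; a; b; c; d; a (+) b (+) c (+) d] i.

Lemma even_code_signs t : even_signs (code_signs t).
Proof.
case: t => [[[a b] c] d]; rewrite /even_signs odd_sum !big_ord_recr big_ord0 /=.
by case: a b c d => [] [] [] [].
Qed.

Lemma code_signs_ex e : even_signs e ->
  exists b t, e =1 (fun i => b (+) code_signs t i).
Proof.
rewrite /even_signs odd_sum !big_ord_recl big_ord0.
set e0 := e _; set e1 := e _; set e2 := e _; set e3 := e _; set e4 := e _; set e5 := e _ => ev.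
exists e0, (e0 (+) e1, e0 (+) e2, e0 (+) e3, e0 (+) e4) => i /=.
have -> : e i = nth false [:: e0; e1; e2; e3; e4; e5] i.
  by case: i => [[|[|[|[|[|[|//]]]]]] ?]; congr e; apply: val_inj.
move: e0 e1 e2 e3 e4 e5 ev.
by case: i => [[|[|[|[|[|[|//]]]]]] ? /=] [] [] [] [] [] [].
Qed.

Lemma code_signs_inj b t b' t' :
  (forall i, b (+) code_signs t i = b' (+) code_signs t' i) -> b = b' /\ t = t'.
Proof.
case: t t' => [[[a1 a2] a3] a4] [[[c1 c2] c3] c4] E.
have := E (@Ordinal 6 0 isT); have := E (@Ordinal 6 1 isT); have := E (@Ordinal 6 2 isT).
have := E (@Ordinal 6 3 isT); have := E (@Ordinal 6 4 isT) => /= E4 E3 E2 E1.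
rewrite !addbF => bb; subst b'; split=> //.
by move: E1 E2 E3 E4 => /addbI-> /addbI-> /addbI-> /addbI->.
Qed.

Lemma scale_spmx_inj (F : fieldType) c s e s' e' : c != 0 ->
  c *: spmx F s e = spmx F s' e' -> s = s' /\ forall i, c * (-1) ^+ e i = (-1) ^+ e' i.
Proof.
move=> c0 /matrixP E.
have ss : s = s'.
  apply/permP => i; apply/eqP; have /eqP := E i (s i); rewrite !mxE eqxx mulr1n.
  by apply: contraTT => /negPf->; rewrite mulr0n mulf_neq0 ?expf_neq0 ?oppr_eq0 ?oner_eq0.
by split=> // i; have := E i (s i); rewrite !mxE ss eqxx !mulr1n.
Qed.

(** * The automorphism groups *)

Lemma frame_orth (R : comNzRingType) : (frame R)^T *m frame R = 2%:M.
Proof.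
apply/matrixP => i j; rewrite !mxE !big_ord_recr big_ord0 /= add0r !mxE /=.
by case: i j => [[|[|[|[|[|[|//]]]]]] ?] [[|[|[|[|[|[|//]]]]]] ?] /=;
  rewrite !(mulr0z, mulrNz, mulr1z); ring.
Qed.

Section AutMx.
Variable F : numFieldType.
Let two0 : (2 : F) != 0. Proof. by rewrite pnatr_eq0. Qed.

(** Conjugation by [frame], whose inverse is half its transpose. *)
Definition autmx s e : 'M[F]_6 := 2^-1 *: ((frame F)^T *m spmx F s e *m frame F).

Lemma frameK : 2^-1 *: ((frame F)^T *m frame F) = 1%:M.
Proof. by rewrite frame_orth scale_scalar_mx mulVf. Qed.

Lemma frameKV : 2^-1 *: (frame F *m (frame F)^T) = 1%:M.
Proof. by rewrite scalemxAr; apply: mulmx1C; rewrite -scalemxAl frameK. Qed.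

Lemma frame_conj (A : 'M[F]_6) :
  2^-1 *: ((frame F)^T *m (2^-1 *: (frame F *m A *m (frame F)^T)) *m frame F) = A.
Proof.
rewrite -!scalemxAr -!scalemxAl !mulmxA -[X in 2^-1 *: (2^-1 *: X)]mulmxA.
rewrite -[(frame F)^T *m frame F *m A]mulmxA.
rewrite scalerA mulrC -scalerA scalemxAr frameK mulmx1.
by rewrite mulmxA scalemxAl frameK mul1mx.
Qed.

Lemma frame_autmx s e : frame F *m autmx s e = spmx F s e *m frame F.
Proof. by rewrite -scalemxAr !mulmxA -mulmxA scalemxAl frameKV mul1mx. Qed.

Lemma autmxM s e s' e' :
  autmx s e *m autmx s' e' = autmx (s * s')%g (fun i => e i (+) e' (s i)).
Proof. by rewrite {1}/autmx -scalemxAl -!mulmxA frame_autmx /autmx -spmxM !mulmxA. Qed.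

Lemma autmx_unit s e : autmx s e \in unitmx.
Proof.
have := unitmx1 F 6; rewrite -frameK scalemxAl unitmx_mul => /andP[uT uf].
by rewrite /autmx -mulmxA scalemxAl !unitmx_mul uT spmx_unit.
Qed.

Lemma autmx_neg s e b : autmx s (fun i => b (+) e i) = (-1) ^+ b *: autmx s e.
Proof.
rewrite /autmx scalerA mulrC -scalerA; congr (_ *: _).
rewrite scalemxAl scalemxAr; congr (_ *m _ *m _).
by apply/matrixP => i j; rewrite !mxE signr_addb mulrnAr.
Qed.

Lemma scale_autmx_inj c s e s' e' : c != 0 ->
  c *: autmx s e = autmx s' e' -> s = s' /\ forall i, c * (-1) ^+ e i = (-1) ^+ e' i.
Proof.
move=> c0 /(congr1 (mulmx (frame F))); rewrite -scalemxAr !frame_autmx.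
have := unitmx1 F 6; rewrite -frameK scalemxAl unitmx_mul => /andP[_ uf].
rewrite scalemxAl => /(can_inj (mulmxK uf)); exact: scale_spmx_inj.
Qed.

End AutMx.

Lemma map_autmx (F F' : numFieldType) (g : {rmorphism F -> F'}) s e :
  map_mx g (autmx F s e) = autmx F' s e.
Proof.
rewrite /autmx map_mxZ fmorphV rmorph_nat !map_mxM -matrix.map_trmx.
have -> : map_mx g (frame F) = frame F' by apply/matrixP => i j; rewrite !mxE rmorph_int.
by congr (_ *: (_ *m _ *m _)); apply/matrixP => i j;
  rewrite !mxE rmorphMn rmorphXn rmorphN rmorph1.
Qed.

Lemma code_signs0 t : code_signs t ord0 = false.
Proof. by case: t => [[[]]]. Qed.

Lemma card_eq_finType (T : finType) U (A : set U) (g : T -> U) n :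
  injective g -> (forall x, A x <-> exists t, x = g t) -> #|T| = n -> (A #= `I_n)%card.
Proof.
move=> g_inj gA <-.
have -> : A = ((g \o enum_val) @` [set: 'I_#|T|])%classic.
  apply/seteqP; split=> x /=.
    by move=> /gA[t ->]; exists (enum_rank t) => //=; rewrite enum_rankK.
  by move=> [i _ <-]; apply/gA; exists (enum_val i).
apply: (card_eq_trans (inj_card_eq _)); last by rewrite card_eq_sym; exact: card_II.
by move=> i j _ _ /= /g_inj/enum_val_inj.
Qed.

Section Automorphisms.
Variable C : numClosedFieldType.

Lemma autmx_preserves s e (A : GL C 6) : even_signs e -> A = autmx C s e :> 'M_6 ->
  preserves (L24 C) A.
Proof.
move=> ev AE; have LA x : L24 C (A *m x) <-> L24 C x.
  by rewrite !L24P AE mulmxA frame_autmx -mulmxA sextic_spmx.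
apply/asboolP/seteqP; split=> [_ [x Lx <-]|x Lx]; first exact/LA.
have uA : (A : 'M_6) \in unitmx by exact: Defs.GL_unit.
by exists (invmx A *m x); [apply/LA|]; rewrite mulKVmx.
Qed.

(** Conjugation by [frame] turns the hypersurface into the zeros of the sextic,
    whose stabilizer is known. *)
Lemma linaut_autmx (A : linaut (L24 C)) :
  exists c s e, [/\ c != 0, even_signs e & A = c *: autmx C s e :> 'M_6].
Proof.
have AL : preserves (L24 C) A by case: A.
pose B := 2^-1 *: (frame C *m A *m (frame C)^T).
have AE : A = 2^-1 *: ((frame C)^T *m B *m frame C) :> 'M_6 by rewrite frame_conj.
have uB : B \in unitmx.
  by have := Defs.GL_unit A; rewrite AE -mulmxA scalemxAl !unitmx_mul => /and3P[].
have [|c [s [e [c0 ev BE]]]] := sextic_stabilizer uB.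
  move=> y y0; pose x := 2^-1 *: ((frame C)^T *m y).
  have fx : frame C *m x = y by rewrite -scalemxAr mulmxA scalemxAl frameKV mul1mx.
  have -> : B *m y = frame C *m (A *m x) by rewrite /B -scalemxAl -!scalemxAr -!mulmxA.
  apply/L24P; have /asboolP/seteqP[sub _] := AL; apply: sub.
  by exists x => //; apply/L24P; rewrite fx.
exists c, s, e; split=> //.
by rewrite AE BE -scalemxAr -scalemxAl scalerA mulrC -scalerA.
Qed.


(** Codes for the even signed permutations. The global sign comes last because
    dropping it leaves a code for the class modulo plus or minus 1. *)
Definition weyl_code : finType := ('S_6 * code * bool)%type.

Definition wperm (w : weyl_code) : 'S_6 := w.1.1.
Definition wsigns (w : weyl_code) : 'I_6 -> bool := fun i => w.2 (+) code_signs w.1.2 i.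

Lemma even_wsigns w : even_signs (wsigns w).
Proof. exact/even_signs_neg/even_code_signs. Qed.

Lemma weyl_codeP s e : even_signs e -> exists w, s = wperm w /\ e = wsigns w.
Proof. by move=> /code_signs_ex[b [t eE]]; exists (s, t, b); split=> //; apply/funext. Qed.

Lemma weyl_code_inj w w' : wperm w = wperm w' -> wsigns w =1 wsigns w' -> w = w'.
Proof.
case: w w' => [[s t] b] [[s' t'] b']; rewrite /wperm /wsigns /= => ->.
by case/code_signs_inj => -> ->.
Qed.

Lemma card_code : #|{: 'S_6 * code}| = 11520.
Proof. by rewrite !card_prod !card_bool card_Sn. Qed.

Lemma card_weyl_code : #|weyl_code| = 23040.
Proof. by rewrite card_prod card_bool card_code. Qed.

Definition weyl_GL w : GL C 6 := MkGL (autmx_unit C (wperm w) (wsigns w)).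

Fact weyl_linaut_subproof w : preserves (L24 C) (weyl_GL w).
Proof. exact: autmx_preserves (even_wsigns w) _. Qed.
Definition weyl_linaut w : linaut (L24 C) := Linaut (weyl_linaut_subproof w).

Fact weyl_real_subproof w : is_real (weyl_linaut w).
Proof.
apply/mxOver_realP; rewrite /= -(map_autmx (ratr : {rmorphism rat -> C})) -map_mx_comp.
by apply/matrixP => i j; rewrite mxE [RHS]mxE; exact: fmorph_rat.
Qed.
Definition weyl_real_linaut w : real_linaut (L24 C) := RealLinaut (weyl_real_subproof w).

Lemma PAut_surj (x : PAut (L24 C)) : exists p, x = PAut_class (weyl_linaut (p, false)).
Proof.
elim/quotg_ind: x => A; have [c [s [e [c0 ev AE]]]] := linaut_autmx A.
have [[[s' t] b] [sE eE]] := weyl_codeP s ev.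
exists (s', t); apply/esym/PAut_classP; exists (c * (-1) ^+ b).
  by rewrite mulf_neq0 ?expf_neq0 ?oppr_eq0 ?oner_eq0.
by rewrite AE sE eE /wsigns autmx_neg scalerA.
Qed.

Lemma PAut_inj : injective (fun p => PAut_class (weyl_linaut (p, false))).
Proof.
move=> p q /PAut_classP[c c0 /= /esym E]; have [s1 c1] := scale_autmx_inj c0 E.
move: p q {E} s1 c1 => [s t] [s' t']; rewrite /wperm /wsigns /= => -> c1.
have c_eq1 : c = 1.
  have := c1 ord0; rewrite !code_signs0 => /=; by rewrite mulr1.
by have [i|_ ->] := @code_signs_inj false t false t'; first by have := c1 i;
  rewrite c_eq1 mul1r => /signr_inj.
Qed.

(** The scalar factor of a real automorphism is real, and its sign can be moved
    into the signed permutation, as six sign changes are an even number. *)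
Lemma PpAutR_surj (x : PpAutR (L24 C)) : exists w, x = PpAutR_class (weyl_real_linaut w).
Proof.
elim/quotg_ind: x => A; have [c [s [e [c0 ev AE]]]] := linaut_autmx A.
have [w [sE eE]] := weyl_codeP s ev.
have cR : c \is Num.real.
  have wR := weyl_real_subproof w; have AR : is_real A by case: A {AE}.
  have [[i j] /= ij|z] := pickP (fun ij => autmx C s e ij.1 ij.2 != 0); last first.
    have A0 : autmx C s e = 0.
      by apply/matrixP => i j; rewrite [RHS]mxE; apply/eqP/negbFE/(z (i, j)).
    by have := autmx_unit C s e; rewrite A0 unitmxE det0 unitr0.
  have -> : c = A i j / autmx C s e i j by rewrite AE mxE mulfK.
  by rewrite rpred_div //; [exact: (mxOverP AR)|rewrite sE eE; exact: (mxOverP wR)].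
have [b cb] : exists b : bool, 0 < c * (-1) ^+ b.
  move: cR; rewrite realE => /orP[cp|cn]; first by exists false; rewrite mulr1 lt_def c0.
  by exists true; rewrite mulrN1 oppr_gt0 lt_def eq_sym c0.
have [w' [sE' eE']] := weyl_codeP s (even_signs_neg b ev).
exists w'; apply/esym/PpAutR_classP; exists (c * (-1) ^+ b) => //=.
by rewrite AE -sE' -eE' autmx_neg [RHS]scalerA -mulrA -signr_addb addbb mulr1.
Qed.

Lemma PpAutR_inj : injective (fun w => PpAutR_class (weyl_real_linaut w)).
Proof.
move=> w w' /PpAutR_classP[c c0 /= /esym E]; have [s1 c1] := scale_autmx_inj (lt0r_neq0 c0) E.
have c_eq1 : c = 1.
  by rewrite -(gtr0_norm c0) -(normr_sign C (wsigns w' ord0)) -c1 mulrC normrMsign.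
by apply: weyl_code_inj => // i; have := c1 i; rewrite c_eq1 mul1r => /signr_inj.
Qed.

Lemma weyl_code_mul w w' : exists w'',
  wperm w'' = (wperm w * wperm w')%g /\ wsigns w'' = fun i => wsigns w i (+) wsigns w'
    (wperm w i).
Proof.
have [w'' [-> ->]] := weyl_codeP (wperm w * wperm w')%g
  (even_signs_mul (wperm w) (even_wsigns w) (even_wsigns w')).
by exists w''.
Qed.

Lemma card_PAut : ([set: PAut (L24 C)] #= `I_11520)%card.
Proof.
apply: (card_eq_finType PAut_inj _ card_code) => x; split=> // _.
exact: PAut_surj.
Qed.

Lemma card_PpAutR : ([set: PpAutR (L24 C)] #= `I_23040)%card.
Proof.
apply: (card_eq_finType PpAutR_inj _ card_weyl_code) => x; split=> // _.
exact: PpAutR_surj.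
Qed.

Lemma PAut_rational :
  (group_closure (@PAut_class C 6 (L24 C) @` rational_linaut (L24 C)) = [set: PAut (L24
    C)])%classic.
Proof.
apply/seteqP; split=> // x _ H _; apply; have [p ->] := PAut_surj x.
exists (weyl_linaut (p, false)) => //.
by exists (autmx rat (wperm (p, false)) (wsigns (p, false))); rewrite map_autmx.
Qed.

End Automorphisms.

(** * The Weyl group of type D_6 *)

Section WeylGroup.
Variable R : realFieldType.

Definition spGL s e : GL R 6 := MkGL (spmx_unit R s e).

Lemma spGL_M s e s' e' : (spGL s e * spGL s' e')%g = spGL (s * s')%g (fun i => e i (+) e'
  (s i)).
Proof. by apply: val_inj; exact: spmxM. Qed.

Lemma spGL_1 : spGL 1%g (fun=> false) = 1%g.
Proof. by apply: val_inj; exact: spmx1. Qed.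

Definition pair_signs (i j k : 'I_6) := (k == i) (+) (k == j).

Definition reflections : set (GL R 6) :=
  [set A : GL R 6 | exists2 a, @rootsD R 6 a & is_reflection a A]%classic.

(** The reflection in e_i - e_j exchanges the two coordinates, the reflection in
    e_i + e_j exchanges them and changes both signs. *)
Lemma reflection_spmx (i j : 'I_6) (b b' : bool) (A : GL R 6) : i != j ->
  is_reflection ((-1) ^+ b *: delta_mx i 0 + (-1) ^+ b' *: delta_mx j 0) A <->
  A = spGL (tperm i j) (fun k => (b == b') && pair_signs i j k).
Proof.
move=> ij; set a := (X in is_reflection X); set S := spGL _ _.
have aE k : a k 0 = (-1) ^+ b * (k == i)%:R + (-1) ^+ b' * (k == j)%:R by rewrite !mxE !andbT.
have dotE (v : 'cV[R]_6) : Defs.dotmx v a = (-1) ^+ b * v i 0 + (-1) ^+ b' * v j 0.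
  rewrite /Defs.dotmx; under eq_bigr do rewrite aE mulrDr !mulrA ![_ * (-1) ^+ _]mulrC.
  rewrite big_split /= (bigD1 i) //= [X in _ + X](bigD1 j) //= !eqxx !mulr1.
  by rewrite !big1 ?addr0 // => k /negPf->; rewrite mulr0.
have aa : Defs.dotmx a a = 2.
  by rewrite dotE !aE !eqxx [j == i]eq_sym (negPf ij) !(mulr0, mulr1, addr0, add0r)
    -!expr2 !sqrr_sign.
have two0 : (2 : R) != 0 by rewrite pnatr_eq0.
have SE (v : 'cV[R]_6) : (S : 'M_6) *m v = v - (2 * Defs.dotmx v a / Defs.dotmx a a) *: a.
  apply/colP => k; rewrite spmxE aa [2 * _]mulrC mulfK // dotE [RHS]mxE [X in _ + X]mxE
    [X in _ - X]mxE aE /pair_signs.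
  have [->|ki] := eqVneq k i.
    rewrite tpermL (negPf ij) /= andbT; move: (v i 0) (v j 0) => x y.
    by case: (b) (b') => [] []; rewrite /= ?expr0 ?expr1; ring.
  have [->|kj] := eqVneq k j.
    rewrite tpermR /= andbT; move: (v i 0) (v j 0) => x y.
    by case: (b) (b') => [] []; rewrite /= ?expr0 ?expr1; ring.
  by rewrite tpermD 1?eq_sym // andbF mul1r !mulr0 addr0 mulr0 subr0.
split=> [AR|->]; last exact: SE.
apply/val_inj/matrixP => k l; have := AR (delta_mx l 0); rewrite -SE.
by rewrite -!colE => /colP/(_ k); rewrite !mxE.
Qed.

Lemma pair_signs_even i j : even_signs (pair_signs i j).
Proof.
rewrite /even_signs odd_sum big_split /=.
have E l : \big[addb/false]_k (k == l) = true.
  by rewrite (bigD1 l) //= eqxx big1 // => k /negPf.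
by rewrite !E.
Qed.

(** Reflections in the roots e_i - e_j generate the permutations. The product of
    the reflections in e_i - e_j and e_i + e_j changes two signs, and every even
    sign change is a product of such changes, all of them involving the first
    coordinate. *)
Lemma group_closure_reflections (A : GL R 6) :
  group_closure reflections A <-> exists s e, even_signs e /\ A = spGL s e.
Proof.
have ev0 : even_signs (fun=> false) by rewrite /even_signs big1.
split=> [|[s [e [ev ->]]] H HG rH].
  pose H : set (GL R 6) := [set A | exists s e, even_signs e /\ A = spGL s e]%classic.
  move=> /(_ H) clA; apply: clA => [|B [_ [i [j [b [b' [ij ->]]]]] /(reflection_spmx _ _
    _ ij)->]].
    split=> [|X Y /set_mem[s [e [ev ->]]] /set_mem[s' [e' [ev' ->]]]]; apply/mem_set.
      by exists 1%g, (fun=> false); rewrite spGL_1.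
    have YV : ((spGL s' e')^-1 = spGL s'^-1 (fun i => e' (s'^-1 i)))%g.
      apply/(mulgI (spGL s' e')); rewrite mulgV spGL_M mulgV -spGL_1; congr spGL.
      by apply/funext => i; rewrite permK addbb.
    rewrite YV spGL_M; do 2!eexists; split; last by [].
    apply: (@even_signs_mul s e (fun i => e' (s'^-1%g i))) => //;
      rewrite /even_signs (reindex_inj (@perm_inj _ s')) /=.
    by under eq_bigr do rewrite permK.
  exists (tperm i j), (fun k => (b == b') && pair_signs i j k); split=> //.
  by case: (b == b') => //=; exact: pair_signs_even.
have HM X Y : H X -> H Y -> H (X * Y)%g.
  by move=> /mem_set HX /mem_set HY; apply/set_mem; exact: (group_closedM HG).
have H1 : H 1%g by apply/set_mem; case: HG.
have Hrefl i j b : i != j -> H (spGL (tperm i j) (fun k => b && pair_signs i j k)).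
  move=> ij; apply: rH; exists ((-1) ^+ b *: delta_mx i 0 + (-1) ^+ true *: delta_mx j 0).
    by exists i, j, b, true.
  apply/(reflection_spmx _ _ _ ij); congr spGL.
  by apply/funext => k; rewrite eqb_id.
have Hperm : H (spGL s (fun=> false)).
  have [ts -> tsP] := prod_tpermP s; elim: ts tsP => [|t ts IH] /=.
    by rewrite big_nil spGL_1.
  move=> /andP[t12 /IH Hts]; rewrite big_cons.
  by have := HM _ _ (Hrefl t.1 t.2 false t12) Hts; rewrite spGL_M.
have Hpair i j : H (spGL 1%g (pair_signs i j)).
  have [<-|ij] := eqVneq i j.
    rewrite (_ : pair_signs i i = fun=> false) ?spGL_1 //.
    by apply/funext => k; rewrite /pair_signs addbb.
  have := HM _ _ (Hrefl i j true ij) (Hrefl i j false ij); rewrite spGL_M tperm2.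
  by congr (H (spGL _ _)); apply/funext => k; rewrite addbF.
have -> : spGL s e = (spGL 1 e * spGL s (fun=> false))%g.
  by rewrite spGL_M mul1g; congr spGL; apply/funext => k; rewrite addbF.
apply: (HM) => //.
have eE : e = fun k => \big[addb/false]_i (e i && pair_signs ord0 i k).
  apply/funext => k; rewrite /pair_signs; under eq_bigr do rewrite andb_addr.
  rewrite big_split /= [X in X (+) _](_ : _ = false).
    rewrite (bigD1 k) //= eqxx andbT big1 ?addbF // => i /negPf.
    by rewrite eq_sym => ->; rewrite andbF.
  case: (k == ord0); last by rewrite big1 // => i _; rewrite andbF.
  under eq_bigr do rewrite andbT.
  by rewrite -odd_sum; exact/negbTE.
rewrite eE; elim: (index_enum _) => [|i r IH].
  rewrite (_ : (fun k => _) = fun=> false) ?spGL_1 //.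
  by apply/funext => k; rewrite big_nil.
have := IH; case ei : (e i); last first.
  by congr (H (spGL _ _)); apply/funext => k; rewrite big_cons ei.
move=> /(HM _ _ (Hpair ord0 i)); rewrite spGL_M mul1g.
by congr (H (spGL _ _)); apply/funext => k; rewrite perm1 big_cons ei.
Qed.

End WeylGroup.

(** The isomorphism goes through the parameters: that both groups compute products
    by common parameters stands in for a group law on T. *)
Lemma ex_multiplicative_bij (T : Type) (G H : groupType) (g : T -> G) (h : T -> H) :
  (forall x, exists t, x = g t) -> injective g ->
  (forall y, exists t, y = h t) -> injective h ->
  (forall t t', exists t'', g t'' = (g t * g t')%g /\ h t'' = (h t * h t')%g) ->
  exists f : {multiplicative G -> H}, bijective f.
Proof.
move=> /choice[g' gK] g_inj /choice[h' hK] h_inj ghM.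
have g'K : cancel g g' by move=> t; apply: g_inj; rewrite -gK.
have h'K : cancel h h' by move=> t; apply: h_inj; rewrite -hK.
have fM : {morph h \o g' : x y / (x * y)%g}.
  move=> x y; have [t [gt ht]] := ghM (g' x) (g' y).
  by rewrite /= {1}(gK x) {1}(gK y) -gt g'K ht.
pose F : {multiplicative G -> H} := HB.pack (h \o g') (isMultiplicative.Build G H (h \o
  g') fM).
by exists F; exists (g \o h') => x /=; rewrite ?h'K ?g'K -?gK -?hK.
Qed.

Section WeylIso.
Variables (C : numClosedFieldType) (R : realFieldType).

Fact weyl_elt_subproof w : spGL R (wperm w) (wsigns w) \in group_closure (reflections (R
  := R)).
Proof.
apply/mem_set/group_closure_reflections.
by exists (wperm w), (wsigns w); split=> //; exact: even_wsigns.
Qed.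

Definition weyl_elt w : weylD R 6 := GeneratedType (weyl_elt_subproof w).

Lemma weyl_elt_inj : injective weyl_elt.
Proof.
move=> w w' /(congr1 (fun x : weylD R 6 => (generated_val x : 'M_6))) /= E.
have [] := @scale_spmx_inj R 1 (wperm w) (wsigns w) (wperm w') (wsigns w') (oner_neq0 R).
  by rewrite scale1r.
by move=> ss cc; apply: weyl_code_inj => // i; apply: (@signr_inj R); rewrite -cc mul1r.
Qed.

Lemma weyl_elt_surj x : exists w, x = weyl_elt w.
Proof.
case: x => A clA; have /set_mem/group_closure_reflections[s [e [ev AE]]] := clA.
by have [w [sE eE]] := weyl_codeP s ev; exists w; apply: val_inj; rewrite /= AE sE eE.
Qed.

Lemma PpAutR_weylD : exists f : {multiplicative PpAutR (L24 C) -> weylD R 6}, bijective f.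
Proof.
apply: (ex_multiplicative_bij (@PpAutR_surj C) (@PpAutR_inj C) weyl_elt_surj weyl_elt_inj).
move=> w w'; have [w'' [sE eE]] := weyl_code_mul w w'; exists w''; split.
  rewrite [RHS]quotg_class_mul; congr quotg_class.
  by do 3!apply: val_inj; rewrite /= autmxM sE eE.
by do 2!apply: val_inj; rewrite /= spmxM sE eE.
Qed.

End WeylIso.

(** * Nonnegative automorphisms *)

(** Two columns of a nonnegative matrix are orthogonal only if their supports are
    disjoint. Every row then has one nonzero entry, and this entry is 1. *)
Lemma nonneg_orthogonal_perm (F : numDomainType) n (A : 'M[F]_n) :
  A \is a mxOver Num.nneg -> A^T *m A = 1%:M ->
  exists s : 'S_n, A = \matrix_(k, l) (k == s l)%:R.
Proof.
move=> /mxOverP A0 /matrixP AA.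
have ge0 i j k : 0 <= A k i * A k j by apply: mulr_ge0; apply: A0.
have orth i j k : i != j -> A k i * A k j = 0.
  move=> ij; have := AA i j; rewrite !mxE (negPf ij) => /eqP.
  under eq_bigr do rewrite mxE; rewrite psumr_eq0 => // /allP/(_ k).
  by rewrite mem_index_enum => /(_ isT)/eqP.
have norm1 i : \sum_k A k i ^+ 2 = 1.
  by have := AA i i; rewrite !mxE eqxx => E; rewrite -[RHS]/(true%:R) -E;
    apply: eq_bigr => k _; rewrite mxE.
have [f fP] : exists f, forall l, A (f l) l != 0.
  apply: (@fin_all_exists _ _ (fun l k => A k l != 0)) => l.
  have [k Ak|z] := pickP (fun k => A k l != 0); first by exists k.
  have /eqP := norm1 l; rewrite big1 ?(eq_sym 0) ?oner_eq0 // => k _.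
  by rewrite (eqP (negbFE (z k))) expr0n.
have row0 l l' : l' != l -> A (f l) l' = 0.
  by rewrite eq_sym => /(orth _ _ (f l))/eqP; rewrite mulf_eq0 (negPf (fP l)) => /eqP.
have f_inj : injective f.
  move=> l l' ff; apply/eqP/negPn/negP; rewrite eq_sym => ll.
  by have := fP l'; rewrite -ff row0 // eqxx.
exists (perm f_inj); apply/matrixP => k l; rewrite mxE permE.
have [l' ->] : exists l', k = f l'.
  by have [g _ gK] := injF_bij f_inj; exists (g k); rewrite gK.
rewrite (inj_eq f_inj); have [->|ll] := eqVneq l' l; last by rewrite row0 1?eq_sym.
have := norm1 l; rewrite (bigD1 (f l)) //= big1 ?addr0 => [/eqP|j jl].
  by rewrite sqrf_eq1 => /orP[/eqP//|/eqP E]; have := A0 (f l) l;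
    rewrite nnegrE E oppr_ge0 ler10.
have [l'' jE] : exists l', j = f l'.
  by have [g _ gK] := injF_bij f_inj; exists (g j); rewrite gK.
by rewrite jE row0 ?expr0n //; apply: contraNneq jl => ->; rewrite jE.
Qed.

Definition star (v : 'I_4) : {set 'I_6} := [set k | (v == (edge k).1) || (v == (edge k).2)].

Definition same_edge (k : 'I_6) (i j : 'I_4) := (edge k == (i, j)) || (edge k == (j, i)).

Lemma edge_lt k : ((edge k).1 < (edge k).2)%N.
Proof. by apply/edgeP; exists k; case: (edge k). Qed.

Lemma same_edge_star k i j : i != j -> same_edge k i j = (k \in star i) && (k \in star j).
Proof.
rewrite /same_edge !inE; case: (edge k) => a b /= ij; rewrite !xpair_eqE.
rewrite ![_ == i]eq_sym ![_ == j]eq_sym.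
have [<-|ia] := eqVneq i a; first by rewrite /= [j == i]eq_sym (negPf ij) /= orbF.
by have [<-|ib] := eqVneq i b; rewrite ?andbF //= andbT [j == i]eq_sym (negPf ij) orbF.
Qed.

Lemma same_edge_inj k l i j : same_edge k i j -> same_edge l i j -> k = l.
Proof.
move=> ki lj; apply: edge_inj; move: ki lj (edge_lt k) (edge_lt l); rewrite /same_edge.
by do 2![case/orP=> /eqP->] => //= ij ji; have := ltn_trans ij ji; rewrite ltnn.
Qed.

Lemma same_edge_ex i j : i != j -> exists k, same_edge k i j.
Proof.
rewrite -val_eqE neq_ltn => /orP[] /edgeP[k kE]; exists k; rewrite /same_edge kE eqxx ?orbT //.
Qed.

Lemma same_edgeC k i j : same_edge k i j = same_edge k j i.
Proof. by rewrite /same_edge orbC. Qed.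

Lemma same_edge_refl k : same_edge k (edge k).1 (edge k).2.
Proof. by rewrite /same_edge -surjective_pairing eqxx. Qed.

Lemma edge_perm_ex (s : 'S_4) : exists p : 'S_6,
  forall l, same_edge (p l) (s (edge l).1) (s (edge l).2).
Proof.
have [f fP] : exists f, forall l, same_edge (f l) (s (edge l).1) (s (edge l).2).
  apply: (@fin_all_exists _ _ (fun l k => same_edge k (s (edge l).1) (s (edge l).2))) => l.
  apply: same_edge_ex; rewrite (inj_eq perm_inj) -val_eqE neq_ltn edge_lt //.
have f_inj : injective f.
  move=> k l fkl; have := fP k; have := fP l; rewrite fkl /same_edge.
  have e12 : same_edge k (edge l).1 (edge l).2 -> k = l.
    by move=> h; apply: (same_edge_inj h); exact: same_edge_refl.
  case/orP=> /eqP->; rewrite !xpair_eqE !(inj_eq perm_inj) => /orP[] /andP[/eqP E1 /eqP E2];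
    apply: e12; rewrite /same_edge [edge k]surjective_pairing -E1 -E2 ?eqxx ?orbT //.
exists (perm f_inj) => l; rewrite permE; exact: fP.
Qed.

Lemma relabeling_mxE (C : numClosedFieldType) (s : 'S_4) (p : 'S_6) :
  (forall l, same_edge (p l) (s (edge l).1) (s (edge l).2)) ->
  relabeling_mx C s = \matrix_(k, l) (k == p l)%:R.
Proof.
move=> pP; apply/matrixP => k l; rewrite !mxE; congr (nat_of_bool _)%:R.
rewrite -/(same_edge k (s (edge l).1) (s (edge l).2)).
by apply/idP/eqP => [h|->//]; apply: (same_edge_inj h).
Qed.

Section Nonnegative.
Variable C : numClosedFieldType.

Definition indicator (E : {set 'I_6}) : 'cV[C]_6 := \col_k (k \in E)%:R.

(** Among the sets of three edges, the stars, the triangles and the paths, only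
    the stars have a planar realization with squared lengths 1 on the set and 0
    elsewhere: the value of [cayley] is -1 on the others. *)
Lemma star_of_indicator (E : {set 'I_6}) : #|E| = 3 -> L24 C (indicator E) ->
  exists v, E = star v.
Proof.
set b := fun k (lt_k6 : (k < 6)%N) => Ordinal lt_k6 \in E.
have bE k : (k \in E) = nth false [:: b 0 isT; b 1 isT; b 2 isT; b 3 isT; b 4 isT; b 5 isT] k.
  by case: k => [[|[|[|[|[|[|//]]]]]] ?]; apply: (congr1 (fun k : 'I_6 => k \in E));
    exact: val_inj.
rewrite -sum1_card big_mkcond !big_ord_recr big_ord0 /= !bE /=.
rewrite /L24 /preimage /= M24P !mxE !bE /=.
have star_ex v : (forall k : 'I_6, nth false [:: b 0 isT; b 1 isT; b 2 isT; b 3 isT;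
  b 4 isT; b 5 isT] k = (k \in star v)) ->
    exists v, E = star v.
  by move=> h; exists v; apply/setP => k; rewrite bE h.
have m1 : (-1 : C) = 0 -> False by move/eqP; rewrite oppr_eq0 oner_eq0.
move: (b 0 isT) (b 1 isT) (b 2 isT) (b 3 isT) (b 4 isT) (b 5 isT) star_ex {bE}.
move=> [] [] [] [] [] [] star_ex // _ c0.
all: first [ by case: m1; rewrite -[RHS]c0 /cayley /=; ring
           | by apply: (star_ex (@Ordinal 4 0 isT)) => -[[|[|[|[|[|[|//]]]]]] ?]; rewrite inE
           | by apply: (star_ex (@Ordinal 4 1 isT)) => -[[|[|[|[|[|[|//]]]]]] ?]; rewrite inE
           | by apply: (star_ex (@Ordinal 4 2 isT)) => -[[|[|[|[|[|[|//]]]]]] ?]; rewrite inE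
           | by apply: (star_ex (@Ordinal 4 3 isT)) => -[[|[|[|[|[|[|//]]]]]] ?];
             rewrite inE ].
Qed.

Lemma indicator_star v : L24 C (indicator (star v)).
Proof.
(* All the vertices but v are at the origin. *)
exists (\matrix_(i, k) ((i == v) && (k == 0))%:R) => //.
apply/colP => k; rewrite !mxE !inE /sqdist !big_ord_recr big_ord0 /= !mxE /= !andbF
  !andbT subrr expr0n addr0 add0r.
have := edge_lt k; case: (edge k) => a b /= ab; rewrite ![v == _]eq_sym.
have [<-|_] := eqVneq a v; last by rewrite sub0r sqrrN.
by rewrite -val_eqE (gtn_eqF ab) subr0.
Qed.

Lemma star_inj : injective star.
Proof.
move=> u v uv; apply/eqP/negPn/negP => nuv.
have [w wu wv] : exists2 w, w != u & w != v.
  have /card_gt0P[w] : (0 < #|~: [set u;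
    v]|)%N by rewrite cardsCs finset.setCK card_ord cards2 nuv.
  by rewrite !inE negb_or => /andP[]; exists w.
have [k ku] := same_edge_ex wu; have := same_edge_star k wu; rewrite ku => /esym/andP[kw].
rewrite uv => kv; have : same_edge k w v by rewrite same_edge_star // kw.
by move: ku; rewrite /same_edge => /orP[] /eqP->;
  rewrite !xpair_eqE ?eqxx (negPf nuv) ?andbF ?(eq_sym u) (negPf wu) (negPf wv).
Qed.

Lemma card_star v : #|star v| = 3.
Proof.
rewrite -sum1_card big_mkcond !big_ord_recr big_ord0 /= !inE.
by case: v => [[|[|[|[|//]]]] ?].
Qed.

(** As [frame] is orthogonal up to a factor, the automorphism is an orthogonal
    matrix, so if nonnegative it permutes the edges. This permutation maps stars
    to stars, hence comes from a permutation of the vertices. *)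
Lemma autmx_nonneg_relabeling s e : even_signs e ->
  autmx C s e \is a mxOver Num.nneg -> exists t, autmx C s e = relabeling_mx C t.
Proof.
move=> ev A0; set A := autmx C s e in A0 *.
have AT : A^T *m A = 1%:M.
  have -> : A^T = autmx C s^-1%g (fun i => e (s^-1%g i)).
    rewrite /A /autmx linearZ /= !trmx_mul trmxK mulmxA; congr (_ *: (_ *m _ *m _)).
    apply/matrixP => i j; rewrite !mxE; have [->|ij] := eqVneq i (s j).
      by rewrite permK eqxx.
    by rewrite (_ : j == _ = false) //; apply: contraNF ij => /eqP->; rewrite permKV.
  rewrite autmxM mulVg /autmx (_ : (fun i => _) = fun=> false); last first.
    by apply/funext => i; rewrite addbb.
  by rewrite spmx1 mulmx1 frameK.
have [p Ap] := nonneg_orthogonal_perm A0 AT.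
have Aind E : A *m indicator E = indicator (p @: E).
  apply/colP => k; rewrite Ap !mxE (bigD1 (p^-1%g k)) //= !mxE permKV eqxx mul1r big1 ?addr0.
    by rewrite -[in k \in p @: E](permKV p k) mem_imset //; exact: perm_inj.
  move=> l lk; rewrite !mxE; case: eqVneq => [kp|]; last by rewrite mul0r.
  by move: lk; rewrite kp permK eqxx.
have LA x : L24 C x -> L24 C (A *m x).
  by rewrite !L24P mulmxA frame_autmx -mulmxA sextic_spmx.
have [f fP] : exists f, forall v, p @: star v = star (f v).
  apply: (@fin_all_exists _ _ (fun v w => p @: star v = star w)) => v.
  apply: star_of_indicator; first by rewrite card_imset ?card_star //; exact: perm_inj.
  by rewrite -Aind; apply/LA/indicator_star.
have f_inj : injective f.
  move=> u v fuv; apply: star_inj; apply: (imset_inj (@perm_inj _ p)).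
  by rewrite !fP fuv.
exists (perm f_inj); rewrite Ap; apply/esym/relabeling_mxE => l.
have e12 : (edge l).1 != (edge l).2 by rewrite -val_eqE neq_ltn edge_lt.
rewrite same_edge_star ?(inj_eq perm_inj) // !permE -!fP !mem_imset; try exact: perm_inj.
by rewrite -same_edge_star ?same_edge_refl.
Qed.

End Nonnegative.

Section NonnegativeSet.
Variable C : numClosedFieldType.
Local Open Scope classical_set_scope.
Local Open Scope card_scope.

Lemma sqdistC (p : 'M[C]_(4, 2)) i j : sqdist p i j = sqdist p j i.
Proof. by apply: eq_bigr => k _; rewrite -sqrrN opprB. Qed.

Lemma relabeling_mx_spmx (s : 'S_4) (p : 'S_6) :
  (forall l, same_edge (p l) (s (edge l).1) (s (edge l).2)) ->
  relabeling_mx C s = spmx C p^-1%g (fun=> false).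
Proof.
move=> pP; rewrite (relabeling_mxE C pP); apply/matrixP => k l; rewrite !mxE expr0.
by congr (nat_of_bool _)%:R; apply/eqP/eqP => ->; rewrite ?permK ?permKV.
Qed.

Lemma relabeling_mx_L24 (s : 'S_4) (x : 'cV[C]_6) : L24 C (relabeling_mx C s *m x) <-> L24 C x.
Proof.
have [p pP] := edge_perm_ex s; rewrite (relabeling_mx_spmx pP).
have xE l : (spmx C p^-1%g (fun=> false) *m x) (p l) 0 = x l 0.
  by rewrite spmxE permK mul1r.
have sE (q : 'M[C]_(4, 2)) l :
    sqdist q (edge (p l)).1 (edge (p l)).2 = sqdist q (s (edge l).1) (s (edge l).2).
  by have /orP[/eqP->|/eqP->] := pP l; rewrite // sqdistC.
split=> [[q _ /colP qE]|[q _ /colP qE]].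
  exists (\matrix_i row (s i) q) => //; apply/colP => l.
  rewrite mxE [RHS]mxE -xE; have := qE (p l); rewrite mxE [X in _ = X]mxE sE => <-.
  by apply: eq_bigr => k _; rewrite !mxE.
exists (\matrix_i row (s^-1%g i) q) => //; apply/colP => k; rewrite -[k](permKV p).
rewrite mxE [RHS]mxE xE sE; have := qE (p^-1%g k); rewrite mxE [X in _ = X]mxE => <-.
by apply: eq_bigr => j _; rewrite !mxE !permK.
Qed.

Lemma relabeling_linaut_ex (s : 'S_4) : exists A : real_linaut (L24 C), A = relabeling_mx
  C s :> 'M_6.
Proof.
have uS : relabeling_mx C s \in unitmx.
  by have [p pP] := edge_perm_ex s; rewrite (relabeling_mx_spmx pP) spmx_unit.
have pS : preserves (L24 C) (MkGL uS).
  apply/asboolP/seteqP; split=> [_ [x Lx <-]|x Lx]; first exact/relabeling_mx_L24.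
  by exists (invmx (relabeling_mx C s) *m x); [apply/(relabeling_mx_L24 s)|]; rewrite mulKVmx.
have rS : is_real (Linaut pS) by apply/mxOverP => i j; rewrite mxE; exact: realn.
by exists (RealLinaut rS).
Qed.

Lemma relabeling_mx_inj c (s t : 'S_4) : c != 0 ->
  relabeling_mx C s = c *: relabeling_mx C t -> s = t.
Proof.
move=> c0 /matrixP E; have {}E k l :
    same_edge k (s (edge l).1) (s (edge l).2) = same_edge k (t (edge l).1) (t (edge l).2).
  have /eqP := E k l; rewrite !mxE -/(same_edge k _ _) -/(same_edge k _ _).
  by case: (same_edge k _ _) (same_edge k _ _) => [] [];
    rewrite ?mulr1 ?mulr0 // ?(eq_sym 0) ?oner_eq0 ?(negPf c0).
have {}E i j k : i != j -> same_edge k (s i) (s j) = same_edge k (t i) (t j).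
  move=> ij; have [l lE] := same_edge_ex ij; have := E k l.
  by case/orP: lE => /eqP-> //=; rewrite same_edgeC [RHS]same_edgeC.
have sub u v : u != v -> s v = t v \/ s v = t u.
  move=> uv; have [k kE] : exists k, same_edge k (s v) (s u).
    by apply: same_edge_ex; rewrite (inj_eq perm_inj) eq_sym.
  have := kE; rewrite E 1?eq_sym //; move: kE; rewrite /same_edge.
  by case/orP=> /eqP-> /orP[] /eqP[E1 E2]; rewrite ?E1 ?E2; [left|right|right|left].
(* The vertex s v is the common end of the images of two edges at v. *)
apply/permP => v.
have [u uv] : exists u, u != v.
  have /card_gt0P[u] : (0 < #|~: [set v]|)%N by rewrite cardsCs finset.setCK card_ord cards1.
  by rewrite !inE; exists u.
have [w wu wv] : exists2 w, w != u & w != v.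
  have /card_gt0P[w] : (0 < #|~: [set u;
    v]|)%N by rewrite cardsCs finset.setCK card_ord cards2 uv.
  by rewrite !inE negb_or => /andP[]; exists w.
have [//|su] := sub _ _ uv; have [//|sw] := sub _ _ wv.
by move: wu; rewrite -(inj_eq (@perm_inj _ t)) -sw su eqxx.
Qed.

Lemma nonnegativeP (A : real_linaut (L24 C)) :
  nonnegative (L24 C) (PpAutR_class A) <-> (A : 'M_6) \is a mxOver Num.nneg.
Proof.
split=> [/(_ A erefl)//|/mxOverP A0 B /esym/PpAutR_classP[c c0 ->]].
by apply/mxOverP => i j; rewrite mxE; apply: rpredM; [rewrite nnegrE ltW|].
Qed.

Lemma nonnegative_relabelings : nonnegative (L24 C) = relabelings C.
Proof.
apply/seteqP; split=> [x|_ [s [A [AE ->]]]].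
  have [w ->] := PpAutR_surj x => /nonnegativeP /= A0.
  have [t tE] := autmx_nonneg_relabeling (even_wsigns w) A0.
  by exists t, (weyl_real_linaut C w).
by apply/nonnegativeP; rewrite AE; apply/mxOverP => i j; rewrite mxE nnegrE ler0n.
Qed.

Lemma card_nonnegative : nonnegative (L24 C) #= `I_24.
Proof.
have [g gE] := choice relabeling_linaut_ex.
apply: (@card_eq_finType _ _ _ (fun s => PpAutR_class (g s))).
- move=> s t /PpAutR_classP[c c0]; rewrite !gE => E.
  exact/esym/(relabeling_mx_inj (lt0r_neq0 c0) E).
- move=> x; rewrite nonnegative_relabelings; split=> [[s [A [AE ->]]]|[s ->]].
    by exists s; apply/PpAutR_classP; exists 1; rewrite ?ltr01 // scale1r gE AE.
  by exists s, (g s).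
by rewrite card_Sn.
Qed.

Lemma subgroup_nonnegative : subgroup_set (nonnegative (L24 C)).
Proof.
split=> [|x y /set_mem Nx /set_mem Ny]; apply/mem_set.
  apply/(nonnegativeP 1%g)/mxOverP => i j; rewrite mxE nnegrE; case: eqVneq => //= _;
    exact: ler01.
have := Nx; have := Ny; rewrite {1 2}nonnegative_relabelings => -[s [B [BE ->]]] [t [A
  [AE ->]]].
rewrite [(_^-1)%g]quotg_class_inv [(_ * _)%g]quotg_class_mul; apply/nonnegativeP.
have [p pP] := edge_perm_ex s; have [q qP] := edge_perm_ex t.
rewrite /= AE BE (relabeling_mx_spmx pP) (relabeling_mx_spmx qP).
have -> : invmx (spmx C p^-1%g (fun=> false)) = spmx C p (fun=> false).
  by rewrite -[LHS]mulmx1 -(spmx1 C) -(mulVg p) -(spmxM _ _ (fun=> false) _ (fun=>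
    false)) mulKmx ?spmx_unit.
by rewrite spmxM; apply/mxOverP => i j; rewrite mxE /= nnegrE; case: eqP => _;
  rewrite ?ler01 ?lexx.
Qed.

End NonnegativeSet.

Local Open Scope classical_set_scope.
Local Open Scope card_scope.
Local Open Scope ring_scope.

Theorem theorem6p16 (R : realType) :
  [/\ [set: PAut (L24 R[i])] #= `I_11520,
      11520%N = (768 * 15)%N &
      group_closure (@PAut_class R[i] 6 (L24 R[i]) @` rational_linaut (L24 R[i]))
        = [set: PAut (L24 R[i])] ]
  /\
  [/\ [set: PpAutR (L24 R[i])] #= `I_23040,
      exists f : {multiplicative PpAutR (L24 R[i]) -> weylD R 6}, bijective f,
      subgroup_set (nonnegative (L24 R[i])),
      nonnegative (L24 R[i]) #= `I_24 &
      nonnegative (L24 R[i]) = relabelings R[i] ].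
Proof.
split; split.
- exact: card_PAut.
- by [].
- exact: PAut_rational.
- exact: card_PpAutR.
- exact: PpAutR_weylD.
- exact: subgroup_nonnegative.
- exact: card_nonnegative.
- exact: nonnegative_relabelings.
Qed.
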